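(* Let $G$ be a countable group, let $X$ be a locally compact Hausdorff space with an action of $G$ by homeomorphisms, and let $Y\subseteq X$ be a closed $G$-invariant subset. Then $Y$ is split-closed in $X$ in each of the following cases: 1. $G$ acts properly on an invariant neighbourhood of $Y$ in $X$ and $Y$ is second countable. 2. $Y$ admits a $G$-invariant tubular neighbourhood.
   Context: $C_0(X)$ denotes the $C^*$-algebra of continuous complex functions on $X$ vanishing at infinity, with the induced $G$-action. For a closed $G$-invariant subset $Y$ of $X$ there is an exact sequence of $G$-$C^*$-algebras $0\to C_0(X\setminus Y)\to C_0(X)\to C_0(Y)\to 0$ (extension by zero and restriction). $Y$ is called split-closed in $X$ if this sequence is semisplit, i.e. the restriction map $C_0(X)\to C_0(Y)$ admits a $G$-equivariant completely positive contractive linear right inverse. A $G$-invariant tubular neighbourhood of $Y$ consists of a $G$-invariant open neighbourhood $U$ of $Y$ in $X$ together with a continuous $G$-equivariant retraction $r\colon U\to Y$ and a continuous $G$-invariant (radial) function $\rho\colon U\to [0,\infty)$ with $\rho|_Y=0$ such that the restriction of $r$ to $\rho^{-1}([0,1])$ is proper. *)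

(* Defs.v *)
From HB Require Import structures.
From mathcomp Require Import all_boot all_order all_algebra complex.
From mathcomp Require Import all_classical all_reals all_analysis.

Set Implicit Arguments.
Unset Strict Implicit.
Unset Printing Implicit Defensive.

Import Order.TTheory GRing.Theory Num.Theory.
Import numFieldTopology.Exports numFieldNormedType.Exports.

Local Open Scope classical_set_scope.
Local Open Scope ring_scope.

(* The ascription to [numClosedFieldType] is what gives R[i] the topology
   of its modulus. *)
Definition cplx (R : realType) : numClosedFieldType := R[i].

Definition modulus (R : realType) (z : cplx R) : R := Normc.normc z.

Definition proper_map (S T : topologicalType) (f : S -> T) : Prop :=
  continuous f /\ forall K : set T, compact K -> compact (f @^-1` K).

Section topology_lemmas.
Variable C : numClosedFieldType.

Lemma closed_norm_ge (X : topologicalType) (f : X -> C) (e : C) :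
  0 < e -> continuous f -> closed [set x | e <= `|f x|].
Proof.
move=> e0 cf; rewrite -openC.
rewrite openE => x /= /negP nfx.
have {}nfx : `|f x| < e by rewrite real_ltNge ?ger0_real ?(ltW e0).
have d0 : 0 < e - `|f x| by rewrite subr_gt0.
have nb : nbhs x [set y | ball (f x) (e - `|f x|) (f y)].
  exact: (cf x _ (nbhsx_ballx (f x) _ d0)).
apply: filterS nb => y /=; rewrite -ball_normE /ball_ /= => fy; apply/negP.
rewrite -real_ltNge ?ger0_real ?(ltW e0)//.
rewrite -[f y](subrK (f x)) (le_lt_trans (ler_normD _ _))//.
by rewrite -ltrBrDr distrC.
Qed.

Lemma compact_set_val_preimage (X : topologicalType) (Y K : set X) :
  closed Y -> compact K -> compact ((@set_val X Y) @^-1` K).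
Proof.
move=> cY cK F FF FK.
have FsY : (set_val @ F) Y.
  by apply: (@filterE _ F) => y; exact: set_valP.
have [p [Kp clp]] := cK (set_val @ F) (fmap_proper_filter _ FF) FK.
have Yp : Y p.
  apply: cY => V Vp; have [q [Yq Vq]] := clp _ _ FsY Vp.
  by exists q; split.
exists (exist _ p (mem_set Yp)); split; first exact: Kp.
move=> A B FA [_ [[V oV <-] Vp] VB].
have FA' : (set_val @ F) (set_val @` A).
  by apply: (@filterS _ F _ A) FA => a Aa /=; exists a.
have [_ [[a Aa <-] Va]] := clp _ _ FA' (open_nbhs_nbhs (conj oV Vp)).
by exists a; split => //; exact: VB.
Qed.

End topology_lemmas.

Section C0.
Variables (C : numClosedFieldType) (X : topologicalType).

(* [0 < e] in [C] forces [e] to be real. *)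
Definition vanishes_at_infinity (f : X -> C) : Prop :=
  forall e : C, 0 < e -> compact [set x | e <= `|f x|].

Definition C0_pred : {pred X -> C} :=
  mem [set f : X -> C | continuous f /\ vanishes_at_infinity f].

Record C0 : Type := MkC0 { C0_fun :> X -> C; _ : C0_fun \in C0_pred }.

HB.instance Definition _ := [isSub for C0_fun].
HB.instance Definition _ := [Choice of C0 by <:].

Lemma C0P (f : C0) : continuous f /\ vanishes_at_infinity f.
Proof. by case: f => f /= /set_mem. Qed.

Lemma C0_ext (f g : C0) : f =1 g -> f = g.
Proof. by move=> fg; apply/val_inj/funext. Qed.

Lemma vanishes_sub2 (f g h : X -> C) (t : C -> C) :
  (forall e, 0 < e -> 0 < t e) ->
  (forall e x, 0 < e -> `|f x| < t e -> `|g x| < t e -> `|h x| < e) ->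
  continuous h -> vanishes_at_infinity f -> vanishes_at_infinity g ->
  vanishes_at_infinity h.
Proof.
move=> t0 fgh ch vf vg e e0.
apply: (@subclosed_compact _ _
  ([set x | t e <= `|f x|] `|` [set x | t e <= `|g x|])).
- exact: closed_norm_ge.
- by apply: compactU; [apply: vf|apply: vg]; exact: t0.
- move=> x /= ehx.
  have tr : t e \is Num.real by rewrite ger0_real// ltW// t0.
  have [tf|tf] := real_leP tr (normr_real (f x)); first by left.
  have [tg|tg] := real_leP tr (normr_real (g x)); first by right.
  by have := lt_le_trans (fgh e x e0 tf tg) ehx; rewrite ltxx.
Qed.

Lemma C0_submod_closed : submod_closed C0_pred.
Proof.
split.
  apply/mem_set; split; first by move=> x; exact: cst_continuous.
  move=> e e0; rewrite [X in compact X](_ : _ = set0); first exact: compact0.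
  by apply/seteqP; split => // x /=; rewrite normr0 (lt_geF e0).
move=> a f g /set_mem[cf vf] /set_mem[cg vg]; apply/mem_set.
have ch : continuous (a *: f + g).
  by move=> x; apply: cvgD (cg x); apply: cvgM (cf x); exact: cvg_cst.
split=> //.
pose t (e : C) := e / (`|a| + 1).
have a1 : 0 < `|a| + 1 by rewrite ltr_wpDl.
apply: (@vanishes_sub2 f g _ t) => //.
  by move=> e e0; rewrite divr_gt0.
move=> e x e0 fx gx; have -> : e = `|a| * t e + t e.
  by rewrite -[X in _ + X]mul1r -mulrDl /t mulrC divfK// gt_eqF.
apply: le_lt_trans (ler_normD _ _) _; apply: ler_ltD => //.
by rewrite normrM ler_wpM2l// ltW.
Qed.

HB.instance Definition _ := GRing.isSubmodClosed.Build _ _ C0_pred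
  C0_submod_closed.
HB.instance Definition _ := [SubChoice_isSubLmodule of C0 by <:].

Lemma C0_mul_subproof (f g : C0) : (fun x => f x * g x) \in C0_pred.
Proof.
have [cf vf] := C0P f; have [cg vg] := C0P g; apply/mem_set.
have ch : continuous (fun x => f x * g x).
  by move=> x; apply: cvgM; [exact: cf|exact: cg].
split => //; apply: (@vanishes_sub2 f g _ sqrtC) => //.
  by move=> e; rewrite sqrtC_gt0.
move=> e x e0 fx gx; rewrite normrM -[ltRHS]sqrtCK expr2.
by rewrite ltr_pM.
Qed.

Definition C0_mul (f g : C0) : C0 := MkC0 (C0_mul_subproof f g).

Lemma C0_star_subproof (f : C0) : (fun x => (f x)^*) \in C0_pred.
Proof.
have [cf vf] := C0P f; apply/mem_set; split; last first.
  by move=> e e0; under eq_set do rewrite norm_conjC; exact: vf.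
move=> x; apply: (@continuous_comp _ _ _ f Num.conj); first exact: cf.
move=> V /nbhs_ballP[e e0 eV]; apply/nbhs_ballP; exists e => // y xy.
by apply: eV; rewrite /ball /= -rmorphB norm_conjC.
Qed.

Definition C0_star (f : C0) : C0 := MkC0 (C0_star_subproof f).

(* [M = B^* B] in the matrix *-algebra over [C0], where
   [(B^* ) i k = (B k i)^*]. *)
Definition mx_positive n (M : 'M[C0]_n) : Prop :=
  exists B : 'M[C0]_n,
    M = \matrix_(i, j) \sum_(k < n) C0_mul (C0_star (B k i)) (B k j).

End C0.

Arguments C0 : clear implicits.

Definition completely_positive (C : numClosedFieldType)
    (X Y : topologicalType) (s : C0 C Y -> C0 C X) : Prop :=
  forall n (M : 'M[C0 C Y]_n), mx_positive M -> mx_positive (map_mx s M).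

Definition C0_norm (R : realType) (X : topologicalType) (f : C0 (cplx R) X) : R :=
  sup (range (fun x => modulus (f x))).

Definition contractive (R : realType) (X Y : topologicalType)
    (s : C0 (cplx R) Y -> C0 (cplx R) X) : Prop :=
  forall f, C0_norm (s f) <= C0_norm f.

Section restriction.
Variables (C : numClosedFieldType) (X : topologicalType) (Y : set X).

Lemma C0_restrict_subproof (cY : closed Y) (f : C0 C X) :
  sigL Y f \in @C0_pred C Y.
Proof.
have [cf vf] := C0P f; apply/mem_set; split.
  move=> y; apply: (@continuous_comp _ _ _ (@set_val X Y) f); last exact: cf.
  exact: initial_continuous.
move=> e e0.
exact: (@compact_set_val_preimage X Y [set x | e <= `|f x|] cY (vf e e0)).
Qed.

Definition C0_restrict (cY : closed Y) (f : C0 C X) : C0 C Y :=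
  MkC0 (C0_restrict_subproof cY f).

End restriction.

Record homeo_action (G : groupType) (X : topologicalType) : Type := HomeoAction {
  act :> G -> X -> X;
  act1 : forall x, act 1%g x = x;
  actM : forall g h x, act (g * h)%g x = act g (act h x);
  act_continuous : forall g, continuous (act g)
}.

Section actions.
Variables (G : groupType) (X : topologicalType) (a : homeo_action G X).

Definition invariant_set (Y : set X) : Prop := forall g x, Y x -> Y (a g x).

(* [G] carries the discrete topology. *)
Definition proper_action : Prop :=
  proper_map (fun p : discrete_topology G * X => (a p.1 p.2, p.2)).

Section subaction.
Variables (Y : set X) (iY : invariant_set Y).

Definition subact (g : G) (y : Y) : Y :=
  exist _ (a g (set_val y)) (mem_set (iY g (set_valP y))).

Lemma subact1 y : subact 1%g y = y.
Proof. by apply: val_inj; exact: act1. Qed.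

Lemma subactM g h y : subact (g * h)%g y = subact g (subact h y).
Proof. by apply: val_inj; exact: actM. Qed.

Lemma subact_continuous g : continuous (subact g).
Proof.
apply/continuous_comp_initial => y.
apply: (@continuous_comp _ _ _ (@set_val X Y) (a g)).
  exact: initial_continuous.
exact: act_continuous.
Qed.

Definition subaction : homeo_action G Y :=
  HomeoAction subact1 subactM subact_continuous.

End subaction.

Lemma C0_act_subproof (C : numClosedFieldType) (g : G) (f : C0 C X) :
  (fun x => f (a g^-1%g x)) \in @C0_pred C X.
Proof.
have [cf vf] := C0P f; apply/mem_set; split.
  by move=> x; apply: continuous_comp; [exact: act_continuous|exact: cf].
move=> e e0.
rewrite [X in compact X](_ : _ = a g @` [set x | e <= `|f x|]).
  apply: continuous_compact; last exact: vf.
  by apply: continuous_subspaceT => x; exact: act_continuous.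
apply/seteqP; split => [x /= fx|_ [x /= fx <-]].
  by exists (a g^-1%g x) => //; rewrite -actM mulgV act1.
by rewrite -actM mulVg act1.
Qed.

Definition C0_act (C : numClosedFieldType) (g : G) (f : C0 C X) : C0 C X :=
  MkC0 (C0_act_subproof g f).

End actions.

Definition split_closed (R : realType) (G : groupType) (X : topologicalType)
    (a : homeo_action G X) (Y : set X) (cY : closed Y)
    (iY : invariant_set a Y) : Prop :=
  exists s : {linear C0 (cplx R) Y -> C0 (cplx R) X},
    [/\ forall f, C0_restrict cY (s f) = f,
        forall g f, s (C0_act (subaction iY) g f) = C0_act a g (s f),
        completely_positive s
      & contractive s].

Record invariant_tube (R : realType) (G : groupType) (X : topologicalType)
    (a : homeo_action G X) (Y : set X) (iY : invariant_set a Y) : Type :=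
  InvariantTube {
    tube : set X;
    tube_open : open tube;
    tube_sub : Y `<=` tube;
    tube_invariant : invariant_set a tube;
    retr : tube -> Y;
    retr_continuous : continuous retr;
    retr_equivariant : forall g (u : tube),
      retr (subaction tube_invariant g u) = subaction iY g (retr u);
    retrK : forall u : tube, Y (set_val u) -> set_val (retr u) = set_val u;
    radius : tube -> R;
    radius_ge0 : forall u, 0 <= radius u;
    radius_continuous : continuous radius;
    radius_invariant : forall g u,
      radius (subaction tube_invariant g u) = radius u;
    radius_eq0 : forall u : tube, Y (set_val u) -> radius u = 0;
    retr_proper : proper_map (sigL (radius @^-1` `[0, 1]) retr)
  }.

(* Main.v *)
Require Import Defs.
From HB Require Import structures.
From mathcomp Require Import all_boot all_order all_algebra complex.
From mathcomp Require Import all_classical all_reals all_analysis.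
From mathcomp Require Import ring lra.

(** In both cases the section of the restriction map has the form
    [s f x = L x f], where [L x] is a positive linear functional of norm at
    most one on functions on [Y] ([submarkov]), namely a finite combination of
    point evaluations with nonnegative weights of sum at most one.  If
    [x |-> L x f] lies in [C_0(X)], [L y] is evaluation at [y] for [y] in [Y],
    and [L] is equivariant, then [s] is the required splitting
    ([split_closed_of_kernel]).

    Complete positivity comes for free from positivity, because the algebras
    are commutative: a matrix over [C_0(X)] is positive if and only if its value
    at every point is positive semidefinite ([mx_positiveP]), and
    [<s(M)(x) v, v> = L x (y |-> <M(y) v, v>)] is nonnegative.  The implication
    from pointwise positivity to the form [B^* B] needs the positive square
    root of a matrix to depend continuously on the matrix; it is in fact
    1/2-Hoelder ([psd_sub_le]).

    For a tube with retraction [r] and radius [rho] the functional is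
    [L x f = max 0 (1 - rho x) * f (r x)] on the tube and zero off it
    ([tube_split_closed]).

    For a proper action the construction is local.  Near a compact part [K]
    of [Y] there is a non-equivariant extension operator, in the manner of
    Dugundji: second countability of [Y] gives a sequence of continuous
    functions on [X] separating the points of [Y], hence a continuous
    pseudometric [d] on [X] that is a metric on [Y]; a point at positive
    distance from [K] receives an average of the values of [f] at nearly
    closest points of a dense sequence of [K] ([compact_extension_operator]).
    These operators [E n] are then glued along [G] with bump functions
    [psi n] of compact support,
    [L x f = \sum_(n, g) psi n (g^-1 x) * E n (g^-1 x) (f \o g)],
    where [\sum_(n, g) psi n (g^-1 x)] is at most one everywhere and equal to
    one on [Y].  Properness makes the sum over [G] locally finite.  Local
    finiteness in [n] holds on an invariant open neighbourhood of [Y], and is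
    achieved by making the family of orbit sums into a partition of unity with
    the products [t n * \prod_(i < n) (1 - t i)] ([peel]), which vanish for
    large [n] wherever some [t i] equals one. *)

Set Implicit Arguments.
Unset Strict Implicit.
Unset Printing Implicit Defensive.

Import Order.TTheory GRing.Theory Num.Theory.
Import numFieldTopology.Exports numFieldNormedType.Exports.

Local Open Scope classical_set_scope.
Local Open Scope ring_scope.

(** * Positive semidefinite matrices and their square roots *)

Section psd.
Local Open Scope sesquilinear_scope.
Variable C : numClosedFieldType.

Definition psd n (M : 'M[C]_n) : Prop :=
  forall v : 'rV[C]_n, 0 <= (v *m M *m v^t*) 0 0.

Lemma trmxC_mul m n p (A : 'M[C]_(m, n)) (B : 'M[C]_(n, p)) :
  (A *m B)^t* = B^t* *m A^t*.
Proof. by rewrite trmx_mul map_mxM. Qed.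

Lemma form_entry n (P A : 'M[C]_n) k :
  (row k P *m A *m (row k P)^t*) 0 0 = (P *m A *m P^t*) k k.
Proof.
rewrite -row_mul !mxE; apply: eq_bigr => i _; by rewrite !mxE.
Qed.

Lemma spectral_conj n (A : 'M[C]_n) : A \is normalmx ->
  spectralmx A *m A *m (spectralmx A)^t* = diag_mx (spectral_diag A).
Proof.
move=> /orthomx_spectralP AE; have Pu := spectral_unitarymx A.
rewrite [X in _ *m X *m _]AE mulmxA mulmxA mulmxV ?unitarymx_unit// mul1mx.
by rewrite mulmxtVK.
Qed.

Lemma spectralE n (A : 'M[C]_n) : A \is normalmx ->
  A = (spectralmx A)^t* *m diag_mx (spectral_diag A) *m spectralmx A.
Proof.
move=> /orthomx_spectralP {1}->.
by rewrite invmx_unitary// spectral_unitarymx.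
Qed.

Lemma spectral_diagE n (A : 'M[C]_n) k : A \is normalmx ->
  spectral_diag A 0 k
  = (row k (spectralmx A) *m A *m (row k (spectralmx A))^t*) 0 0.
Proof.
by move=> An; rewrite form_entry spectral_conj// !mxE eqxx mulr1n.
Qed.

Lemma form_conj n (A : 'M[C]_n) (v : 'rV[C]_n) :
  (v *m A^t* *m v^t*) 0 0 = ((v *m A *m v^t*) 0 0)^*.
Proof.
have -> : v *m A^t* *m v^t* = (v *m A *m v^t*)^t*.
  by rewrite !trmxC_mul trmxCK mulmxA.
by rewrite !mxE.
Qed.

(** Nonnegativity of the form already forces the matrix to be self-adjoint: the
    skew-adjoint matrix [M - M^*] is normal, and all of its eigenvalues, being
    values of its quadratic form, vanish. *)
Lemma psd_herm n (M : 'M[C]_n) : psd M -> M^t* = M.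
Proof.
move=> pM; pose N := M - M^t*.
have NC : N^t* = - N.
  by rewrite /N linearB/= map_mxB trmxCK opprB.
have Nn : N \is normalmx by apply/normalmxP; rewrite NC mulmxN mulNmx.
apply/esym/eqP; rewrite -subr_eq0 -/N; apply/eqP.
rewrite (spectralE Nn); suff -> : spectral_diag N = 0.
  by rewrite linear0 mulmx0 mul0mx.
apply/rowP => k; rewrite spectral_diagE// mulmxBr mulmxBl.
rewrite mxE [X in _ + X]mxE form_conj.
have /ger0_real/CrealP -> := pM (row k (spectralmx N)).
by rewrite subrr mxE.
Qed.

Lemma psd_normal n (M : 'M[C]_n) : psd M -> M \is normalmx.
Proof. by move=> /psd_herm MC; apply/normalmxP; rewrite MC. Qed.

Definition sqrtmx n (M : 'M[C]_n) : 'M[C]_n :=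
  (spectralmx M)^t* *m diag_mx (map_mx sqrtC (spectral_diag M)) *m spectralmx M.

Lemma psd_diag_ge0 n (M : 'M[C]_n) k : psd M -> 0 <= spectral_diag M 0 k.
Proof. by move=> pM; rewrite spectral_diagE// psd_normal. Qed.

Lemma sqrtmx_mul n (M : 'M[C]_n) : psd M -> sqrtmx M *m sqrtmx M = M.
Proof.
move=> pM; rewrite [RHS](spectralE (psd_normal pM)) /sqrtmx.
set P := spectralmx M; set d := spectral_diag M; set D := diag_mx (map_mx _ _).
have -> : P^t* *m D *m P *m (P^t* *m D *m P) = P^t* *m (D *m D) *m P.
  rewrite !mulmxA; congr (_ *m _ *m _).
  by rewrite mulmxtVK// spectral_unitarymx.
congr (_ *m _ *m _); apply/matrixP => i j; rewrite mul_diag_mx !mxE.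
by rewrite mulrnAr -expr2 sqrtCK.
Qed.

Lemma sqrtmx_psd n (M : 'M[C]_n) : psd M -> psd (sqrtmx M).
Proof.
move=> pM v; rewrite /sqrtmx; set P := spectralmx M; set D := diag_mx _.
have -> : v *m (P^t* *m D *m P) *m v^t*
    = (v *m P^t*) *m D *m (v *m P^t*)^t*.
  by rewrite trmxC_mul trmxCK !mulmxA.
rewrite mxE sumr_ge0// => i _; rewrite mul_mx_diag !mxE.
set z := \sum_ _ _; rewrite mulrAC -normCK mulr_ge0 ?exprn_ge0//.
by rewrite sqrtC_ge0 psd_diag_ge0.
Qed.

Lemma sqrtmx_herm n (M : 'M[C]_n) : psd M -> (sqrtmx M)^t* = sqrtmx M.
Proof. by move=> /sqrtmx_psd/psd_herm. Qed.

Lemma unitarymx_entry_le1 n (P : 'M[C]_n) i j : P \is unitarymx ->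
  `|P i j| <= 1.
Proof.
move=> /unitarymxP/matrixP/(_ i i); rewrite !mxE eqxx => Pii.
rewrite -(@expr_le1 _ 2)// -[leRHS]/(true%:R) -Pii (bigD1 j)//= !mxE -normCK.
by rewrite lerDl sumr_ge0// => k _; rewrite !mxE -normCK exprn_ge0.
Qed.

Lemma ler_sum_cst n (F : 'I_n -> C) e : (forall i, `|F i| <= e) ->
  `|\sum_i F i| <= n%:R * e.
Proof.
move=> Fe; apply: le_trans (ler_norm_sum _ _ _) _.
apply: le_trans (ler_sum _ (fun i _ => Fe i)) _.
by rewrite sumr_const card_ord mulr_natl.
Qed.

(** Hoelder continuity of the square root, stated for [S] and [T] as square
    roots of their squares.  Let [w] be a unit eigenvector of [S - T] with
    eigenvalue [l], and let [p] and [q] be the values of the forms of [S] and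
    [T] at [w].  The form of [S^2 - T^2 = S (S - T) + (S - T) T] at [w] is
    [l * (p + q)], and [`|l| = `|p - q| <= p + q] since [p] and [q] are
    nonnegative; hence [`|l| ^+ 2] is controlled by the entries of
    [S^2 - T^2]. *)
Lemma psd_sub_le n (S T : 'M[C]_n) e : 0 <= e -> psd S -> psd T ->
  (forall i j, `|(S *m S - T *m T) i j| <= e ^+ 2) ->
  forall i j, `|(S - T) i j| <= n%:R * (n%:R * e).
Proof.
move=> e0 pS pT STe i j.
have Dh : (S - T)^t* = S - T by rewrite linearB/= map_mxB !psd_herm.
have Dn : S - T \is normalmx by apply/normalmxP; rewrite Dh.
set P := spectralmx (S - T); set d := spectral_diag (S - T).
have Pu : P \is unitarymx by exact: spectral_unitarymx.
have de k : `|d 0 k| <= n%:R * e.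
  set w := row k P.
  have wD : w *m (S - T) = d 0 k *: w.
    rewrite /w -row_mul (spectralE Dn) !mulmxA (unitarymxP _)// mul1mx.
    by rewrite row_mul row_diag_mx -scalemxAl -rowE.
  have dr : (d 0 k)^* = d 0 k.
    rewrite /d spectral_diagE// -form_conj Dh//.
  have Dw : (S - T) *m w^t* = d 0 k *: w^t*.
    rewrite -Dh -trmxC_mul wD; apply/matrixP => a b.
    by rewrite !mxE rmorphM/= dr.
  pose a := (w *m S *m w^t*) 0 0; pose b := (w *m T *m w^t*) 0 0.
  have a0 : 0 <= a by exact: pS.
  have b0 : 0 <= b by exact: pT.
  have dE : d 0 k = a - b.
    by rewrite /d spectral_diagE// mulmxBr mulmxBl mxE [X in _ + X]mxE.
  have key : (w *m (S *m S - T *m T) *m w^t*) 0 0 = d 0 k * (a + b).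
    have -> : S *m S - T *m T = S *m (S - T) + (S - T) *m T.
      by rewrite mulmxBr mulmxBl addrA subrK.
    rewrite mulmxDr mulmxDl mxE mulrDr; congr (_ + _).
      by rewrite -mulmxA -[S *m _ *m _]mulmxA Dw -!scalemxAr mxE mulmxA.
    by rewrite mulmxA wD -!scalemxAl mxE.
  have le1 : `|d 0 k| ^+ 2 <= `|(w *m (S *m S - T *m T) *m w^t*) 0 0|.
    rewrite key normrM expr2 ler_wpM2l// dE (ger0_norm (addr_ge0 a0 b0)).
    by rewrite (le_trans (ler_normB _ _))// !ger0_norm.
  have le2 : `|(w *m (S *m S - T *m T) *m w^t*) 0 0| <= (n%:R * e) ^+ 2.
    rewrite exprMn expr2 -mulrA mxE; apply: ler_sum_cst => l.
    have we m : `|w 0 m| <= 1 by rewrite mxE; exact: unitarymx_entry_le1.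
    have -> : (w^t*) l 0 = (w 0 l)^* by rewrite !mxE.
    rewrite normrM norm_conjC -[leRHS]mulr1; apply: ler_pM => //.
    rewrite mxE; apply: ler_sum_cst => m.
    rewrite normrM -[leRHS]mul1r; by apply: ler_pM.
  rewrite -(@ler_pXn2r _ 2) ?nnegrE ?mulr_ge0//.
  exact: le_trans le1 le2.
rewrite (spectralE Dn) -/P -/d mxE; apply: ler_sum_cst => k.
rewrite mul_mx_diag !mxE !normrM norm_conjC -[leRHS]mulr1 -[X in X * 1]mul1r.
apply: ler_pM => //; last exact: unitarymx_entry_le1.
by apply: ler_pM => //; exact: unitarymx_entry_le1.
Qed.

End psd.

(** * Positivity of matrices over [C_0(X)] and positive functionals *)

Section positive_matrices_over_C0.
Local Open Scope sesquilinear_scope.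
Variables (C : numClosedFieldType) (X : topologicalType).

Lemma sqrtmx_continuous n (M : X -> 'M[C]_n) (x : X) i j :
  (forall y, psd (M y)) -> (forall k l, (fun y => M y k l) @ x --> M x k l) ->
  (fun y => sqrtmx (M y) i j) @ x --> sqrtmx (M x) i j.
Proof.
move=> pM cM; apply/cvgrPdist_lt => e e0.
(* [psd_sub_le] will bound the entries by [n * (n * r)]; the successor keeps
   the divisor nonzero when [n = 0]. *)
pose N : C := n.+1%:R; have N0 : 0 < N by rewrite ltr0n.
pose r := e / (N * N); have r0 : 0 < r by rewrite divr_gt0// mulr_gt0.
have nearM : \forall y \near x, forall k l, `|M x k l - M y k l| < r ^+ 2.
  apply: filter_forall => k; apply: filter_forall => l.
  by move/cvgrPdist_lt : (cM k l); apply; rewrite exprn_gt0.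
apply: filterS nearM => y My.
have := @psd_sub_le _ _ (sqrtmx (M x)) (sqrtmx (M y)) r (ltW r0)
  (sqrtmx_psd (pM x)) (sqrtmx_psd (pM y)).
rewrite !sqrtmx_mul// => le.
have {}le : `|sqrtmx (M x) i j - sqrtmx (M y) i j| <= n%:R * (n%:R * r).
  rewrite (_ : _ - _ = (sqrtmx (M x) - sqrtmx (M y)) i j); last by rewrite !mxE.
  by apply: le => k l; rewrite !mxE ltW.
apply: le_lt_trans le _.
have -> : e = N * (N * r) by rewrite mulrA mulrC divfK// mulf_neq0// gt_eqF.
have nN : n%:R < N by rewrite ltr_nat.
apply: (@le_lt_trans _ _ (N * (n%:R * r))).
  by apply: ler_wpM2r; [rewrite mulr_ge0// ltW|exact: ltW].
by rewrite ltr_pM2l// ltr_pM2r.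
Qed.

Lemma C0_sumE I (s : seq I) (F : I -> C0 C X) x :
  (\sum_(i <- s) F i) x = \sum_(i <- s) F i x.
Proof. by elim/big_rec2 : _ => // i u v _ <-. Qed.

Definition eval_mx n (M : 'M[C0 C X]_n) (x : X) : 'M[C]_n :=
  \matrix_(i, j) M i j x.

Lemma gram_psd n (B : 'M[C]_n) : psd (B^t* *m B).
Proof.
move=> v; have -> : v *m (B^t* *m B) *m v^t* = (v *m B^t*) *m (v *m B^t*)^t*.
  by rewrite trmxC_mul trmxCK !mulmxA.
by rewrite mxE sumr_ge0// => i _; rewrite !mxE -normCK exprn_ge0.
Qed.

Lemma psd_diag_sqrt n (S : 'M[C]_n) i j : S^t* = S ->
  `|S i j| ^+ 2 <= (S *m S) j j.
Proof.
move=> SC; rewrite -[X in X *m _]SC mxE (bigD1 i)//= !mxE mulrC -normCK.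
by rewrite lerDl sumr_ge0// => k _; rewrite !mxE mulrC -normCK exprn_ge0.
Qed.

(** The square root of a pointwise positive matrix has entries in [C_0]:
    they are continuous by [sqrtmx_continuous], and they vanish at infinity
    because [`|S i j| ^+ 2 <= (S *m S) j j]. *)
Lemma mx_positiveP n (M : 'M[C0 C X]_n) :
  mx_positive M <-> forall x, psd (eval_mx M x).
Proof.
split=> [[B ->] x|pM].
  suff -> : eval_mx (\matrix_(i, j) \sum_(k < n) C0_mul (C0_star (B k i)) (B k j)) x
     = (eval_mx B x)^t* *m eval_mx B x by exact: gram_psd.
  apply/matrixP => i j; rewrite !mxE C0_sumE; apply: eq_bigr => k _.
  by rewrite !mxE.
have SC i j : (fun x => sqrtmx (eval_mx M x) i j) \in @C0_pred C X.
  have cS : continuous (fun x => sqrtmx (eval_mx M x) i j).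
    move=> x; apply: sqrtmx_continuous => // k l; rewrite mxE.
    rewrite (_ : (fun y => _) = M k l); last by apply/funext => y; rewrite mxE.
    by have [+ _] := C0P (M k l); exact.
  apply/mem_set; split=> // e e0; have [_ vM] := C0P (M j j).
  apply: (subclosed_compact _ (vM (e ^+ 2) _)).
  - exact: closed_norm_ge.
  - by rewrite exprn_gt0.
  - move=> x /= ex; have := psd_diag_sqrt i j (sqrtmx_herm (pM x)).
    rewrite sqrtmx_mul// [leRHS]mxE => le.
    have M0 : 0 <= M j j x by apply: le_trans le; exact: exprn_ge0.
    rewrite (ger0_norm M0); apply: le_trans le.
    by rewrite ler_pXn2r ?nnegrE// ltW.
pose B := \matrix_(i, j) MkC0 (SC i j).
have BE i j x : B i j x = sqrtmx (eval_mx M x) i j by rewrite [B i j]mxE.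
exists B; apply/matrixP => i j; apply: C0_ext => x; rewrite [X in _ = C0_fun X x]mxE C0_sumE.
have -> : M i j x = (sqrtmx (eval_mx M x) *m sqrtmx (eval_mx M x)) i j.
  by rewrite sqrtmx_mul// mxE.
rewrite -[X in X *m _]sqrtmx_herm// mxE; apply: eq_bigr => k _ /=.
rewrite !BE; congr (_ * _).
by rewrite [LHS]mxE; congr (_^*); rewrite [LHS]mxE.
Qed.

End positive_matrices_over_C0.

(** A positive functional of norm at most one, acting on arbitrary functions
    on [Z] and seeing only their values on [K]; typically a finite combination
    of evaluations at points of [K]. *)
Definition submarkov (C : numClosedFieldType) (Z : Type) (K : set Z)
    (L : (Z -> C) -> C) : Prop :=
  [/\ forall c f g, L (fun z => c * f z + g z) = c * L f + L g,
      forall f, (forall z, 0 <= f z) -> 0 <= L f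
    & forall f M, 0 <= M -> (forall z, K z -> `|f z| <= M) -> `|L f| <= M].

Section submarkov_lemmas.
Variables (C : numClosedFieldType) (Z : Type).
Implicit Types (K : set Z) (L : (Z -> C) -> C).

Lemma submarkovD K L f g : submarkov K L ->
  L (fun z => f z + g z) = L f + L g.
Proof.
case=> lL _ _; have := lL 1 f g; rewrite mul1r => <-.
by congr L; apply/funext => z; rewrite mul1r.
Qed.

Lemma submarkov0 K L : submarkov K L -> L (fun=> 0) = 0.
Proof.
case=> _ _ bL; apply/eqP; rewrite -normr_le0; apply: bL => // z _.
by rewrite normr0.
Qed.

Lemma submarkovZ K L c f : submarkov K L -> L (fun z => c * f z) = c * L f.
Proof.
move=> sL; have [lL _ _] := sL; have := lL c f (fun=> 0).
rewrite (submarkov0 sL) addr0 => <-.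
by congr L; apply/funext => z; rewrite addr0.
Qed.

Lemma submarkov_sum K L I (s : seq I) (F : I -> Z -> C) : submarkov K L ->
  L (fun z => \sum_(i <- s) F i z) = \sum_(i <- s) L (F i).
Proof.
move=> sL; elim: s => [|i s IH].
  rewrite big_nil -[RHS](submarkov0 sL); congr L.
  by apply/funext => z; rewrite big_nil.
rewrite big_cons -IH -(submarkovD _ _ sL); congr L.
by apply/funext => z; rewrite big_cons.
Qed.

Lemma submarkov_sub K K' L : K `<=` K' -> submarkov K L -> submarkov K' L.
Proof.
by move=> KK' [lL pL bL]; split=> // f M M0 fM; apply: bL => // z /KK'; exact: fM.
Qed.

Lemma submarkov_cst0 K : submarkov K (fun=> 0 : C).
Proof. by split=> [c _ _|//|f M M0 _]; rewrite ?mulr0 ?addr0 ?normr0. Qed.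

Lemma submarkov_eval K z : K z -> submarkov K (fun f : Z -> C => f z).
Proof. by move=> Kz; split=> // f M _; exact. Qed.

(** A positive functional is automatically completely positive: testing against
    a constant vector [v] commutes with the functional. *)
Lemma submarkov_psd K L n (M : Z -> 'M[C]_n) : submarkov K L ->
  (forall z, psd (M z)) -> psd (\matrix_(i, j) L (fun z => M z i j)).
Proof.
move=> sL pM v.
have formE (A : 'M[C]_n) : (v *m A *m map_mx Num.conj v^T) 0 0 =
    \sum_i \sum_j (v 0 j * (v 0 i)^*) * A j i.
  rewrite mxE; apply: eq_bigr => i _; rewrite !mxE mulr_suml.
  by apply: eq_bigr => j _; rewrite mulrAC.
rewrite formE.
suff -> : \sum_i \sum_j v 0 j * (v 0 i)^* * (\matrix_(i, j) L (fun z => M z i j)) j i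
   = L (fun z => \sum_i \sum_j (v 0 j * (v 0 i)^*) * M z j i).
  by have [_ + _] := sL; apply=> z; rewrite -formE; exact: pM.
rewrite (submarkov_sum _ _ sL); apply: eq_bigr => i _.
rewrite (submarkov_sum _ _ sL); apply: eq_bigr => j _.
by rewrite (submarkovZ _ _ sL) mxE.
Qed.

End submarkov_lemmas.

(** * Splittings from kernels of positive functionals *)

Section C0_norm_facts.
Variables (R : realType) (X : topologicalType).
Implicit Type f : C0 (cplx R) X.

Lemma normC_modulus (z : cplx R) : `|z| = (modulus z)%:C%C.
Proof. by case: z. Qed.

Lemma modulus_ge0 (z : cplx R) : 0 <= modulus z.
Proof. by rewrite -ler0c -normC_modulus. Qed.

Lemma C0_bounded f : exists M : R, forall x, modulus (f x) <= M.
Proof.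
have [cf vf] := C0P f.
have := vf 1 ltr01; rewrite compact_near_coveringP.
move=> /(_ R +oo%R (fun M x => modulus (f x) <= M)).
case=> [x _|M [_ HM]].
  have := cf x => /cvgrPdist_lt/(_ 1 ltr01) nf.
  exists ([set y | `|f x - f y| < 1], [set M | modulus (f x) + 1 <= M]).
    split=> //=; near=> M; near: M; apply: nbhs_pinfty_ge; exact: num_real.
  move=> [y M] [/= fy fM]; apply: le_trans fM.
  rewrite -lecR rmorphD/= -!normC_modulus.
  rewrite -[f y](subrK (f x)) addrC (le_trans (ler_normD _ _))// lerD2l.
  by rewrite distrC ltW.
exists (Num.max 1 (M + 1)) => x.
have [fx|fx] := leP 1 (modulus (f x)).
  rewrite le_max; apply/orP; right; apply: (HM (M + 1)); first by rewrite ltrDl.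
  by rewrite /= normC_modulus lecR.
by rewrite le_max ltW.
Unshelve. all: by end_near. Qed.

Lemma modulus_le_C0_norm f x : modulus (f x) <= C0_norm f.
Proof.
have [M fM] := C0_bounded f.
by apply: ub_le_sup; [exists M => _ [y _ <-]|exists x].
Qed.

Lemma C0_norm_ge0 f : 0 <= C0_norm f.
Proof.
have [[x _]|/set0P/negP/negPn/eqP X0] := pselect ([set: X] !=set0).
  exact: le_trans (modulus_ge0 _) (modulus_le_C0_norm f x).
by rewrite /C0_norm X0 image_set0 sup0.
Qed.

Lemma C0_norm_le f M : 0 <= M -> (forall x, modulus (f x) <= M) -> C0_norm f <= M.
Proof.
move=> M0 fM.
have [[x _]|/set0P/negP/negPn/eqP X0] := pselect ([set: X] !=set0).
  by apply: ge_sup; [exists (modulus (f x)), x|move=> _ [y _ <-]].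
by rewrite /C0_norm X0 image_set0 sup0.
Qed.

End C0_norm_facts.

(** The common criterion for both parts of the theorem. *)
Lemma split_closed_of_kernel (R : realType) (G : groupType)
    (X : topologicalType) (a : homeo_action G X) (Y : set X) (cY : closed Y)
    (iY : invariant_set a Y) (L : X -> (Y -> cplx R) -> cplx R) :
  (forall x, submarkov setT (L x)) ->
  (forall f : C0 (cplx R) Y, (fun x => L x f) \in @C0_pred (cplx R) X) ->
  (forall (y : Y) (f : C0 (cplx R) Y), L (set_val y) f = f y) ->
  (forall g x f, L (a g x) f = L x (fun y => f (subact iY g y))) ->
  split_closed R cY iY.
Proof.
move=> mL C0L resL eqvL; pose s f := MkC0 (C0L f).
have s_lin : linear s.
  by move=> c f g; apply: C0_ext => x /=; have [lL _ _] := mL x; rewrite lL.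
pose sL : {linear C0 (cplx R) Y -> C0 (cplx R) X} :=
  HB.pack s (GRing.isLinear.Build _ _ _ _ s s_lin).
exists sL; split.
- by move=> f; apply: C0_ext => y /=; rewrite /sigL /= resL.
- by move=> g f; apply: C0_ext => x /=; rewrite eqvL.
- move=> n M /mx_positiveP pM; apply/mx_positiveP => x.
  have := submarkov_psd (mL x) pM; congr psd; apply/matrixP => i j.
  by rewrite !mxE /=; congr (L x _); apply/funext => y; rewrite mxE.
- move=> f; apply: C0_norm_le; first exact: C0_norm_ge0.
  move=> x; rewrite -lecR -normC_modulus /=; have [_ _] := mL x; apply.
    by rewrite ler0c C0_norm_ge0.
  by move=> y _; rewrite normC_modulus lecR modulus_le_C0_norm.
Qed.

(** Smallness off compact subsets of [W] gives two things at once: vanishing at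
    infinity, and continuity at the points outside [W], since the sets
    [e <= `|F x|] are then closed in [X]. *)
Lemma C0_zero_extension (C : numClosedFieldType) (X : topologicalType)
    (W : set X) (F : X -> C) : hausdorff_space X ->
  (forall x, ~ W x -> F x = 0) -> (forall x, W x -> F @ x --> F x) ->
  (forall e, 0 < e -> exists Q, [/\ compact Q, Q `<=` W
     & forall x, ~ Q x -> `|F x| < e]) ->
  F \in @C0_pred C X.
Proof.
move=> hX F0 cF vF.
have vF' e : 0 < e -> compact [set x | e <= `|F x|] /\
    closed [set x | e <= `|F x|].
  move=> e0; have [Q [cQ QW QF]] := vF e e0.
  have sQ : [set x | e <= `|F x|] `<=` Q.
    by move=> x /=; apply: contraPP => /QF lt /(lt_le_trans lt); rewrite ltxx.
  suff cl : closed [set x | e <= `|F x|].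
    by split=> //; exact: subclosed_compact cl cQ sQ.
  move=> x clx; have Qx : Q x.
    by apply: (compact_closed hX cQ); exact: closureS clx.
  apply: contrapT => /negP; rewrite /= -real_ltNge ?ger0_real ?(ltW e0)// => Fxe.
  have := cF x (QW _ Qx) => /cvgrPdist_lt/(_ (e - `|F x|)).
  rewrite subr_gt0 => /(_ Fxe) /clx [y [/= ey lt]].
  suff : `|F y| < e by move/(le_lt_trans ey); rewrite ltxx.
  rewrite -[F y](subrK (F x)) (le_lt_trans (ler_normD _ _))//.
  by rewrite distrC -ltrBrDr.
apply/mem_set; split=> [x|e e0]; last by have [] := vF' e e0.
have [/cF//|nWx] := pselect (W x).
apply/cvgrPdist_lt => e e0; have [_ cl] := vF' e e0.
have : nbhs x (~` [set x | e <= `|F x|]).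
  apply: open_nbhs_nbhs; split; first exact: closed_openC.
  by rewrite /= F0// normr0; apply/negP; rewrite -real_ltNge ?ger0_real ?(ltW e0).
apply: filterS => y /= /negP; rewrite -real_ltNge ?ger0_real ?(ltW e0)//.
by rewrite (F0 x)// sub0r normrN.
Qed.

(** * Invariant tubular neighbourhoods *)

Lemma nbhs_val_image (X : topologicalType) (W : set X) (u : W) (A : set W) :
  open W -> nbhs u A -> nbhs (set_val u) (set_val @` A).
Proof.
move=> oW [_ [[V oV <-] Vu] VA].
apply: filterS (open_nbhs_nbhs (conj (openI oV oW) (conj Vu (set_valP u)))).
by move=> x [Vx Wx]; exists (exist _ x (mem_set Wx)) => //; exact: VA.
Qed.

Definition extend0 (C : nmodType) (X : Type) (W : set X) (F : W -> C) (x : X) : C :=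
  if insub x is Some u then F u else 0.

Lemma extend0_val (C : nmodType) (X : Type) (W : set X) (F : W -> C) (u : W) :
  extend0 F (set_val u) = F u.
Proof. by rewrite /extend0 valK. Qed.

Lemma extend0_out (C : nmodType) (X : Type) (W : set X) (F : W -> C) x :
  ~ W x -> extend0 F x = 0.
Proof. by move=> nWx; rewrite /extend0 insubN//; apply/negP => /set_mem. Qed.

Lemma extend0_cvg (C : numDomainType) (V : pseudoMetricNormedZmodType C)
    (X : topologicalType) (W : set X) (F : W -> V) (u : W) :
  open W -> F @ u --> F u -> extend0 F @ set_val u --> extend0 F (set_val u).
Proof.
move=> oW cF A; rewrite extend0_val => /cF /(nbhs_val_image oW).
by apply: filterS => _ [w Aw <-]; rewrite /= extend0_val.
Qed.

Section real_weights.
Variable R : realType.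

(** Weights are computed in the ordered field [R], where truncations by [max]
    and [min] are available, and then moved to the complex numbers. *)
Definition weight (t : R) : cplx R := t%:C%C.

Lemma weight_ge0 t : 0 <= t -> 0 <= weight t.
Proof. by rewrite /weight ler0c. Qed.

Lemma weight_le1 t : (weight t <= 1) = (t <= 1).
Proof. by rewrite -[X in weight _ <= X]/(1%:C%C) lecR. Qed.

Lemma norm_weight t : `|weight t| = weight `|t|.
Proof. by rewrite /weight normC_modulus /modulus /= expr0n addr0 sqrtr_sqr. Qed.

Lemma weight_continuous : continuous weight.
Proof.
move=> t; apply/cvgrPdist_lt => e e0.
have ei : e = weight (complex.Re e) by rewrite /weight RRe_real// gtr0_real.
have er : 0 < complex.Re e by rewrite -ltcR -[ltRHS]ei.
have := @cvg_id _ (nbhs t) => /cvgrPdist_lt/(_ _ er).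
by apply: filterS => s /=; rewrite ei -rmorphB norm_weight /weight ltcR.
Qed.

Lemma weight_cvg (T : Type) (F : set_system T) {FF : Filter F} (f : T -> R) l :
  f @ F --> l -> weight \o f @ F --> weight l.
Proof. by move=> fl; apply: continuous_cvg fl => //; exact: weight_continuous. Qed.

Lemma cvg_maxr (T : Type) (F : set_system T) {FF : Filter F} (f g : T -> R) l m :
  f @ F --> l -> g @ F --> m -> (fun t => Num.max (f t) (g t)) @ F --> Num.max l m.
Proof.
move=> fl gm; rewrite maxr_absE.
rewrite (_ : (fun t => _) = (fun t => (f t + g t + `|f t - g t|) / 2)); last first.
  by apply/funext => t; rewrite maxr_absE.
apply: cvgM; last exact: cvg_cst.
by apply: cvgD; [exact: cvgD|apply: cvg_norm; exact: cvgB].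
Qed.

Lemma cvg_minr (T : Type) (F : set_system T) {FF : Filter F} (f g : T -> R) l m :
  f @ F --> l -> g @ F --> m -> (fun t => Num.min (f t) (g t)) @ F --> Num.min l m.
Proof.
move=> fl gm; rewrite minr_absE.
rewrite (_ : (fun t => _) = (fun t => (f t + g t - `|f t - g t|) / 2)); last first.
  by apply/funext => t; rewrite minr_absE.
apply: cvgM; last exact: cvg_cst.
by apply: cvgB; [exact: cvgD|apply: cvg_norm; exact: cvgB].
Qed.

End real_weights.

(** The kernel [max 0 (1 - p x) * f (r x)] is supported where the radius is at
    most one; there [r] is proper, which gives vanishing at infinity. *)
Lemma tube_split_closed (R : realType) (G : groupType) (X : topologicalType)
    (a : homeo_action G X) (Y : set X) (cY : closed Y) (iY : invariant_set a Y) :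
  hausdorff_space X -> invariant_tube R iY -> split_closed R cY iY.
Proof.
move=> hX [W oW YW iW r cr er rK p p0 cp ep pY pr].
pose w (u : W) : R := Num.max 0 (1 - p u).
pose L x f : cplx R := extend0 (fun u : W => weight (w u) * f (r u)) x.
have w0 u : 0 <= w u by rewrite le_max lexx.
have w1 u : w u <= 1 by rewrite ge_max ler01/= lerBlDr lerDl.
have mL x : submarkov setT (L x).
  have [Wx|nWx] := pselect (W x); last first.
    have -> : L x = (fun=> 0) by apply/funext => f; exact: extend0_out.
    exact: submarkov_cst0.
  have LE f : L x f = weight (w (exist _ x (mem_set Wx))) *
      f (r (exist _ x (mem_set Wx))).
    by rewrite -[RHS](extend0_val (fun u => weight (w u) * f (r u))).
  split=> [c f g|f f0|f M M0 fM]; rewrite !LE.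
  - by rewrite mulrDr mulrCA.
  - by rewrite mulr_ge0// weight_ge0.
  - rewrite normrM norm_weight (ger0_norm (w0 _)).
    apply: le_trans (fM _ I); apply: ler_piMl; first exact: normr_ge0.
    by rewrite weight_le1.
apply: (@split_closed_of_kernel R G X a Y cY iY L mL).
- move=> f; have [cf vf] := C0P f.
  apply: (C0_zero_extension (W := W)) => // [x nWx|x Wx|e e0].
  + exact: extend0_out.
  + pose u : W := exist _ x (mem_set Wx); rewrite -[x]/(set_val u).
    apply: extend0_cvg => //.
    have cw : weight (w v) @[v --> nbhs u] --> weight (w u).
      apply: (@weight_cvg R _ (nbhs u) _ w).
      apply: (@cvg_maxr R W (nbhs u)); first exact: cvg_cst.
      by apply: cvgB; [exact: cvg_cst|exact: cp].
    have cfr : f (r v) @[v --> nbhs u] --> f (r u).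
      exact: (@continuous_comp _ _ _ r f u (cr u) (cf _)).
    exact: (cvgM cw cfr).
  + have [_ /(_ _ (vf e e0)) cK] := pr.
    pose S := p @^-1` `[0, 1].
    pose K := sigL S r @^-1` [set y | e <= `|f y|].
    exists (set_val @` (set_val @` K)); split.
    * apply: continuous_compact.
        by apply: continuous_subspaceT; exact: initial_continuous.
      apply: continuous_compact; last exact: cK.
      by apply: continuous_subspaceT; exact: initial_continuous.
    * by move=> _ [u _ <-]; exact: set_valP.
    * move=> x nQ; have [Wx|nWx] := pselect (W x); last first.
        by rewrite /L extend0_out// normr0.
      pose u : W := exist _ x (mem_set Wx).
      have -> : L x f = weight (w u) * f (r u).
        by rewrite -(extend0_val (fun u => weight (w u) * f (r u))).
      have [p1|p1] := leP (p u) 1; last first.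
        rewrite /w max_l ?subr_le0 ?ltW// /weight mul0r normr0//.
      have fe : `|f (r u)| < e.
        rewrite real_ltNge ?ger0_real ?(ltW e0)//; apply/negP => fe.
        have Su : S u by rewrite /S /= in_itv /= p0 p1.
        by apply: nQ; exists u => //; exists (exist _ u (mem_set Su)).
      rewrite normrM norm_weight (ger0_norm (w0 _)) (le_lt_trans _ fe)//.
      by apply: ler_piMl; [exact: normr_ge0|rewrite weight_le1].
- move=> y f; have Wy : W (set_val y) by apply: YW; exact: set_valP.
  pose u : W := exist _ (set_val y) (mem_set Wy).
  have Yu : Y (set_val u) := set_valP y.
  rewrite -[set_val y]/(set_val u) /L extend0_val /w pY// subr0 max_r// mul1r.
  by congr (f _); apply: val_inj; exact: rK.
- move=> g x f; have [Wx|nWx] := pselect (W x); last first.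
    rewrite /L/= (extend0_out _ nWx) extend0_out// => /(iW g^-1%g).
    by rewrite -actM mulVg act1.
  pose u : W := exist _ x (mem_set Wx).
  rewrite -[x]/(set_val u) -[a g _]/(set_val (subaction iW g u)).
  by rewrite /L !extend0_val er /w ep.
Qed.

(** * Bump functions, partitions of unity and locally finite sums *)

(** Otherwise the complements in [K] of the sets satisfying [P] would generate a
    proper filter without cluster point. *)
Lemma compact_induction (X : topologicalType) (P : set X -> Prop) (K : set X) :
  P set0 -> (forall A B, A `<=` B -> P B -> P A) ->
  (forall A B, P A -> P B -> P (A `|` B)) -> compact K ->
  (forall x, K x -> exists2 A, nbhs x A & P A) -> P K.
Proof.
move=> P0 PS PU cK locP; apply: contrapT => nPK.
pose F : set_system X := [set B | exists2 A, P A & K `\` A `<=` B].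
have FF : ProperFilter F.
  split.
    by move=> [A PA]; rewrite subset0 setD_eq0 => /PS/(_ PA).
  split; first by exists set0.
    move=> B B' [A PA AB] [A' PA' AB']; exists (A `|` A'); first exact: PU.
    move=> x [Kx nA]; split.
      by apply: AB; split=> // Ax; apply: nA; left.
    by apply: AB'; split=> // Ax; apply: nA; right.
  by move=> B B' BB' [A PA AB]; exists A => //; exact: subset_trans AB BB'.
have FK : F K by exists set0 => // x [].
have [x [Kx clx]] := cK F FF FK.
have [A nA PA] := locP x Kx.
have FA : F (K `\` A) by exists A.
by have [y [[_ nAy] Ay]] := clx _ _ FA nA.
Qed.

Section clamp.
Variable R : realType.

Definition clamp (t : R) : R := Num.max 0 (Num.min 1 t).

Lemma clamp_ge0 t : 0 <= clamp t.
Proof. by rewrite /clamp le_max lexx. Qed.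

Lemma clamp_le1 t : clamp t <= 1.
Proof. by rewrite /clamp ge_max ler01 ge_min lexx. Qed.

Lemma clamp1 t : 1 <= t -> clamp t = 1.
Proof. by move=> t1; rewrite /clamp min_l// max_r. Qed.

Lemma clamp0 t : t <= 0 -> clamp t = 0.
Proof. by move=> t0; rewrite /clamp max_l// ge_min t0 orbT. Qed.

Lemma cvg_clamp (T : Type) (F : set_system T) {FF : Filter F} (f : T -> R) l :
  f @ F --> l -> (fun t => clamp (f t)) @ F --> clamp l.
Proof.
move=> fl; apply: cvg_maxr; first exact: cvg_cst.
by apply: cvg_minr => //; exact: cvg_cst.
Qed.

End clamp.

Section bump.
Variables (R : realType) (X : topologicalType).
Hypotheses (hX : hausdorff_space X) (lX : locally_compact [set: X]).

Definition bump (W S : set X) (h : X -> R) : Prop :=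
  [/\ continuous h, (forall x, 0 <= h x <= 1), compact S, S `<=` W
    & forall x, ~ S x -> h x = 0].

Lemma bump_cst0 (W : set X) : bump W set0 (fun=> 0).
Proof.
split=> //; [exact: cst_continuous|by move=> x; rewrite lexx ler01|].
exact: compact0.
Qed.

Definition bump_on (W A : set X) : Prop :=
  exists (h : X -> R) (S : set X), bump W S h /\ forall x, A x -> h x = 1.

(** Complete regularity gives only values at points; truncating an affine
    function of the separating function makes it constant near [x] and gives it
    a support inside [W] contained in a compact neighbourhood. *)
Lemma locally_bump (W : set X) x : open W -> W x ->
  exists2 A, nbhs x A & bump_on W A.
Proof.
move=> oW Wx; have [N nN' [cN clN]] := lX (I : setT x).
have nN : nbhs x N.
  by have : \forall y \near x, setT y -> N y := nN'; apply: filterS => y; exact.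
pose B := ~` (W `&` N°).
have clB : closed B.
  by apply: open_closedC; apply: openI => //; exact: open_interior.
have nBx : ~ B x by move=> []; split.
have := @locally_compact_completely_regular X R lX hX x B clB nBx.
move=> /(@uniform_separatorP _ R)[f [cf f01 f0 f1]].
have fx : f x = 0 by apply: f0; exists x.
have cf' := cf x.
(* [2 - 3 * t] is at least 1 for [t <= 1 / 3] and at most 0 for [2 / 3 <= t]. *)
exists [set y | f y <= 3^-1].
  move/cvgrPdist_lt : (cf' : f @ x --> f x) => /(_ 3^-1).
  rewrite invr_gt0 ltr0n => /(_ isT); apply: filterS => y /=.
  rewrite fx sub0r normrN => /ltW/(le_trans (ler_norm _)); exact.
exists (fun y => clamp (2 - 3 * f y)), [set y | f y <= 2 / 3].
have SB : [set y | f y <= 2 / 3] `<=` W `&` N°.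
  move=> y /= fy; apply: contrapT => By; have : f y = 1 by apply: f1; exists y.
  by move=> fy1; move: fy; rewrite fy1; lra.
split; last by move=> y /= fy; apply: clamp1; lra.
split.
- move=> y; apply: cvg_clamp; apply: cvgB; first exact: cvg_cst.
  by apply: cvgM; [exact: cvg_cst|exact: cf].
- by move=> y; rewrite clamp_ge0 clamp_le1.
- apply: (subclosed_compact _ cN); last first.
    by move=> y /SB[_ /interior_subset].
  rewrite (_ : mkset _ = f @^-1` [set t | t <= 2 / 3])//.
  by apply: preimage_closed => //; exact: closed_le.
- by move=> y /SB[].
- by move=> y /= /negP; rewrite -ltNge => fy; apply: clamp0; lra.
Qed.

Lemma compact_bump (W K : set X) : open W -> compact K -> K `<=` W -> bump_on W K.
Proof.
move=> oW cK KW; apply: (@compact_induction _ (bump_on W)) => //.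
- by exists (fun=> 0), set0; split=> //; exact: bump_cst0.
- move=> A B AB [h [S [bh h1]]]; exists h, S; split=> // x /AB.
  exact: h1.
- move=> A B [h [S [[ch h01 cS SW h0] h1]]] [k [T [[ck k01 cT TW k0] k1]]].
  exists (fun x => Num.max (h x) (k x)), (S `|` T).
  split; first split.
  + by move=> x; apply: cvg_maxr; [exact: ch|exact: ck].
  + move=> x; have /andP[hx0 hx1] := h01 x; have /andP[kx0 kx1] := k01 x.
    by rewrite le_max hx0 ge_max hx1.
  + exact: compactU.
  + by move=> x [/SW|/TW].
  + by move=> x /not_orP[/h0 -> /k0 ->]; rewrite maxxx.
  + move=> x ABx; apply/eqP; rewrite eq_le ge_max.
    have /andP[_ ->] := h01 x; have /andP[_ ->] := k01 x.
    by rewrite le_max; case: ABx => [/h1->|/k1->]; rewrite lexx ?orbT.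
- by move=> x /KW; exact: locally_bump.
Qed.

End bump.

Section peel.
Variable R : realType.
Implicit Type t : nat -> R.

(** The part of the unit mass taken by [t n] after [t 0], ..., [t (n - 1)] have
    taken theirs. *)
Definition peel t n : R := t n * \prod_(i < n) (1 - t i).

Lemma peel_sum t N : \sum_(n < N) peel t n = 1 - \prod_(n < N) (1 - t n).
Proof.
elim: N => [|N IH]; first by rewrite !big_ord0 subrr.
by rewrite !big_ord_recr/= IH /peel; ring.
Qed.

Lemma peel_ge0 t n : (forall i, 0 <= t i <= 1) -> 0 <= peel t n.
Proof.
move=> t01; apply: mulr_ge0; first by have /andP[] := t01 n.
by apply: prodr_ge0 => i _; rewrite subr_ge0; have /andP[] := t01 i.
Qed.

Lemma peel_sum_le1 t N : (forall i, 0 <= t i <= 1) -> \sum_(n < N) peel t n <= 1.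
Proof.
move=> t01; rewrite peel_sum gerBl.
by apply: prodr_ge0 => i _; rewrite subr_ge0; have /andP[] := t01 i.
Qed.

Lemma prod_peel0 t m n : t m = 1 -> (m < n)%N -> \prod_(i < n) (1 - t i) = 0.
Proof. by move=> tm mn; rewrite (bigD1 (Ordinal mn))//= tm subrr mul0r. Qed.

(** Local finiteness: where [t m] equals one, nothing is left after step [m]. *)
Lemma peel_eq0 t m n : t m = 1 -> (m < n)%N -> peel t n = 0.
Proof. by move=> tm mn; rewrite /peel (prod_peel0 tm mn) mulr0. Qed.

Lemma peel_sum1 t m N : t m = 1 -> (m < N)%N -> \sum_(n < N) peel t n = 1.
Proof. by move=> tm mN; rewrite peel_sum (prod_peel0 tm mN) subr0. Qed.

Lemma cvg_prod_peel (T : Type) (F : set_system T) {FF : Filter F}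
    (t : nat -> T -> R) (l : nat -> R) n :
  (forall i, t i @ F --> l i) ->
  (fun x => \prod_(i < n) (1 - t i x)) @ F --> \prod_(i < n) (1 - l i).
Proof.
move=> tl; elim: n => [|n IH].
  rewrite big_ord0 (_ : (fun _ => _) = (fun=> 1)); first exact: cvg_cst.
  by apply/funext => x; rewrite big_ord0.
rewrite big_ord_recr (_ : (fun _ => _) =
    (fun x => \prod_(i < n) (1 - t i x) * (1 - t n x))).
  by apply: cvgM => //; apply: cvgB => //; exact: cvg_cst.
by apply/funext => x; rewrite big_ord_recr.
Qed.

End peel.

Section finite_support_sums.

Lemma fsum_restrict (I : choiceType) (V : nmodType) (A : set I) (F : I -> V) :
  (forall i, ~ A i -> F i = 0) ->
  \sum_(i \in [set: I]) F i = \sum_(i \in A) F i.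
Proof.
move=> F0; apply/esym; apply: fsbig_widen => // i [_ /F0].
by [].
Qed.

Lemma fsum_seq (I : choiceType) (V : nmodType) (A : set I) (F : I -> V) :
  finite_set A -> (forall i, ~ A i -> F i = 0) ->
  \sum_(i \in [set: I]) F i = \sum_(i <- finmap.enum_fset (fset_set A)) F i.
Proof. by move=> fA F0; rewrite (fsum_restrict F0) fsbig_finite. Qed.

Lemma cvg_sum_seq (K : numFieldType) (V : pseudoMetricNormedZmodType K)
    (I : Type) (T : Type) (G : set_system T) {FG : Filter G}
    (s : seq I) (F : I -> T -> V) (l : I -> V) :
  (forall i, F i @ G --> l i) ->
  (fun x => \sum_(i <- s) F i x) @ G --> \sum_(i <- s) l i.
Proof.
move=> Fl; elim: s => [|i s IH].
  rewrite big_nil (_ : (fun _ => _) = (fun=> 0)); first exact: cvg_cst.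
  by apply/funext => x; rewrite big_nil.
rewrite big_cons (_ : (fun _ => _) =
    (fun x => F i x + \sum_(j <- s) F j x)); first exact: cvgD.
by apply/funext => x; rewrite big_cons.
Qed.

Lemma cvg_fsum (K : numFieldType) (V : pseudoMetricNormedZmodType K)
    (I : choiceType) (T : topologicalType) (F : I -> T -> V) (A : set I) x :
  finite_set A -> (\forall y \near x, forall i, ~ A i -> F i y = 0) ->
  (forall i, F i @ x --> F i x) ->
  (fun y => \sum_(i \in [set: I]) F i y) @ x --> \sum_(i \in [set: I]) F i x.
Proof.
move=> fA F0 cF; rewrite (fsum_seq fA (nbhs_singleton F0)).
have := @cvg_sum_seq _ _ _ _ _ (nbhs_filter x) (finmap.enum_fset (fset_set A)) F _ cF.
apply: cvg_trans; apply: near_eq_cvg; apply: filterS F0 => y Fy.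
by rewrite (fsum_seq fA Fy).
Qed.

(** The last hypothesis is conditional so that a support condition can be
    checked on the terms that contribute. *)
Lemma submarkov_sum_seq (R : realType) (Z : Type) (K : set Z) (I : eqType)
    (s : seq I) (w : I -> R) (L : I -> (Z -> cplx R) -> cplx R) :
  (forall i, 0 <= w i) -> \sum_(i <- s) w i <= 1 ->
  (forall i, w i != 0 -> submarkov K (L i)) ->
  submarkov K (fun f => \sum_(i <- s) weight (w i) * L i f).
Proof.
move=> w0 w1 mL; split=> [c f g|f f0|f M M0 fM].
- rewrite mulr_sumr -big_split/=; apply: eq_bigr => i _.
  have [->|/mL[-> _ _]] := eqVneq (w i) 0; first by rewrite /weight !mul0r mulr0 addr0.
  by rewrite mulrDr mulrCA.
- apply: sumr_ge0 => i _.
  have [->|/mL[_ pL _]] := eqVneq (w i) 0; first by rewrite /weight mul0r.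
  by rewrite mulr_ge0 ?weight_ge0// pL.
- apply: le_trans (ler_norm_sum _ _ _) _.
  apply: (@le_trans _ _ (\sum_(i <- s) weight (w i) * M)).
    apply: ler_sum => i _; rewrite normrM norm_weight (ger0_norm (w0 i)).
    have [->|/mL[_ _ bL]] := eqVneq (w i) 0; first by rewrite /weight !mul0r.
    by apply: ler_wpM2l; [exact: weight_ge0|exact: bL].
  rewrite -mulr_suml; apply: ler_piMl => //.
  rewrite (_ : \sum_(i <- s) weight (w i) = weight (\sum_(i <- s) w i)).
    by rewrite weight_le1.
  by rewrite /weight rmorph_sum.
Qed.

Lemma submarkov_fsum (R : realType) (Z : Type) (K : set Z) (I : choiceType)
    (A : set I) (w : I -> R) (L : I -> (Z -> cplx R) -> cplx R) :
  finite_set A -> (forall i, ~ A i -> w i = 0) ->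
  (forall i, 0 <= w i) -> \sum_(i \in [set: I]) w i <= 1 ->
  (forall i, w i != 0 -> submarkov K (L i)) ->
  submarkov K (fun f => \sum_(i \in [set: I]) weight (w i) * L i f).
Proof.
move=> fA A0 w0 w1 mL.
rewrite (_ : (fun _ => _) =
    (fun f => \sum_(i <- finmap.enum_fset (fset_set A)) weight (w i) * L i f)).
  by apply: submarkov_sum_seq => //; rewrite -(fsum_seq fA A0).
apply/funext => f; rewrite -(fsum_seq fA)// => i /A0 ->.
by rewrite /weight mul0r.
Qed.

End finite_support_sums.

(** * A pseudometric separating the points of a second countable subspace *)

Lemma second_countable_seq (T : topologicalType) : @second_countable T ->
  exists e : nat -> set T,
    forall x A, nbhs x A -> exists n, [/\ open (e n), e n x & e n `<=` A].
Proof.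
move=> [B /countable_injP[f finj] [oB bB]].
pose e n : set T := [set x | exists U, [/\ B U, f U = n & U x]].
exists e => x A /bB[U [BU Ux] UA].
have eU : e (f U) = U.
  apply/seteqP; split=> [y [V [BV fVU Vy]]|y Uy]; last by exists U.
  by have <- : V = U by apply: finj; rewrite ?inE.
by exists (f U); rewrite eU; split=> //; exact: oB.
Qed.

Section separation.
Variables (R : realType) (X : topologicalType) (Y : set X).
Hypotheses (hX : hausdorff_space X) (lX : locally_compact [set: X]).
Hypothesis scY : @second_countable Y.

(** For each pair of members of a countable base of [Y], pick a continuous
    function on [X] that is 1 on the first and 0 on the second, if there is
    one.  Distinct points of [Y] have disjoint basic neighbourhoods for which
    such a function exists. *)
Lemma separating_sequence : exists H : nat -> X -> R,
  [/\ (forall k, continuous (H k)), (forall k x, 0 <= H k x <= 1)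
    & forall y y' : Y, (forall k, H k (set_val y) = H k (set_val y')) -> y = y'].
Proof.
have [e be] := second_countable_seq scY.
pose good (p : nat * nat) (h : X -> R) := [/\ continuous h,
  (forall x, 0 <= h x <= 1), (forall y, e p.1 y -> h (set_val y) = 1)
  & forall y, e p.2 y -> h (set_val y) = 0].
pose P (k : nat) (h : X -> R) := (continuous h /\ forall x, 0 <= h x <= 1) /\
  forall p, unpickle k = Some p -> (exists h, good p h) -> good p h.
have /choice[H HP] : forall k, exists h, P k h.
  move=> k.
  have [[p [kp [h gh]]]|nh] := pselect (exists p, unpickle k = Some p /\
      exists h, good p h).
    exists h; split; first by have [] := gh.
    by move=> q; rewrite kp => -[<-].
  exists (fun=> 0); split.
    by split; [exact: cst_continuous|move=> x; rewrite lexx ler01].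
  by move=> p kp gp; exfalso; apply: nh; exists p.
exists H; split=> [k|k|y y' Hy]; [by have [[]] := HP k|by have [[]] := HP k|].
apply: contrapT => yy'.
have nyy' : set_val y <> set_val y' by move=> /val_inj.
have oW : open (~` [set set_val y']).
  by apply: closed_openC; apply: accessible_closed_set1; exact: hausdorff_accessible.
have [A nA [h [S [[ch h01 _ SW h0] h1]]]] := locally_bump R hX lX oW nyy'.
have hy : h (set_val y) = 1 by apply: h1; exact: nbhs_singleton nA.
have hy' : h (set_val y') = 0 by apply: h0 => /SW; exact.
have chv : continuous (h \o set_val : Y -> R).
  by move=> z; apply: continuous_comp; [exact: initial_continuous|exact: ch].
have [i [_ eiy ei]] : exists i, [/\ open (e i), e i y & e i `<=` [set z | 2 / 3 < h (set_val z)]].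
  apply: be; move/cvgrPdist_lt : (chv y) => /(_ 3^-1).
  rewrite invr_gt0 ltr0n => /(_ isT); apply: filterS => z /=.
  rewrite hy => /(le_lt_trans (ler_norm _)); lra.
have [j [_ ejy ej]] : exists j, [/\ open (e j), e j y' & e j `<=` [set z | h (set_val z) < 3^-1]].
  apply: be; move/cvgrPdist_lt : (chv y') => /(_ 3^-1).
  rewrite invr_gt0 ltr0n => /(_ isT); apply: filterS => z /=.
  by rewrite hy' sub0r normrN => /(le_lt_trans (ler_norm _)).
(* The affine map sends [2 / 3] to 1 and [1 / 3] to 0. *)
have gh : good (i, j) (fun x => clamp (3 * h x - 1)).
  split=> /=.
  - move=> x; apply: cvg_clamp; apply: cvgB; last exact: cvg_cst.
    by apply: cvgM; [exact: cvg_cst|exact: ch].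
  - by move=> x; rewrite clamp_ge0 clamp_le1.
  - by move=> z /ei/= hz; apply: clamp1; lra.
  - by move=> z /ej/= hz; apply: clamp0; lra.
have [_ /(_ (i, j) (pickleK _))] := HP (pickle (i, j)).
case; first by exists (fun x => clamp (3 * h x - 1)).
move=> _ _ /(_ y eiy) Hy1 /(_ y' ejy); rewrite -Hy Hy1.
by move/eqP; rewrite oner_eq0.
Qed.

Definition continuous_pseudometric (d : X -> X -> R) : Prop :=
  [/\ (forall x, d x x = 0), (forall x y, d x y = d y x),
      (forall x y z, d x z <= d x y + d y z)
    & forall x e, 0 < e -> \forall y \near x, d x y < e].

(** The supremum of [`|H k x - H k y| / (k + 1)] over a separating sequence
    [H].  Continuity needs only finitely many [k], because the remaining terms
    are uniformly small. *)
Lemma exists_pseudometric : exists d : X -> X -> R,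
  continuous_pseudometric d /\
  forall y y' : Y, d (set_val y) (set_val y') = 0 -> y = y'.
Proof.
have [H [cH H01 Hsep]] := separating_sequence.
pose u k x y : R := `|H k x - H k y| / k.+1%:R.
have u0 k x y : 0 <= u k x y by rewrite divr_ge0.
have u1 k x y : u k x y <= k.+1%:R^-1.
  rewrite ler_pdivrMr// mulVf// ler_norml.
  by have /andP[? ?] := H01 k x; have /andP[? ?] := H01 k y; lra.
have uub x y : has_ubound (range (fun k => u k x y)).
  exists 1 => _ [k _ <-]; apply: le_trans (u1 _ _ _) _.
  by rewrite invf_le1// ler1n.
pose d x y := sup (range (fun k => u k x y)).
have ud k x y : u k x y <= d x y by apply: (ub_le_sup (uub x y)); exists k.
have dle x y M : (forall k, u k x y <= M) -> d x y <= M.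
  by move=> uM; apply: ge_sup; [exists (u 0%N x y), 0%N|move=> _ [k _ <-]].
exists d; split; last first.
  move=> y y' dy; apply: Hsep => k; apply/eqP; rewrite -subr_eq0 -normr_le0.
  have := ud k (set_val y) (set_val y'); rewrite dy /u ler_pdivrMr//.
  by rewrite mul0r.
split.
- move=> x; apply/eqP; rewrite eq_le (le_trans (u0 0%N x x) (ud _ _ _)) andbT.
  by apply: dle => k; rewrite /u subrr normr0 mul0r.
- move=> x y; have uC : u ^~ x ^~ y = u ^~ y ^~ x.
    by apply/funext => k; rewrite /u distrC.
  by rewrite /d uC.
- move=> x y z; apply: dle => k; apply: le_trans (lerD (ud k x y) (ud k y z)).
  by rewrite /u -mulrDl ler_wpM2r// ler_distD.
- move=> x e e0.
  have [N Ne] : exists N : nat, N.+1%:R^-1 < e / 2.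
    have := @near_infty_natSinv_lt R (PosNum (divr_gt0 e0 (ltr0n R 2))).
    by move=> [N _ /(_ N (leqnn N))] ?; exists N.
  have nH : \forall y \near x, forall k : 'I_N, `|H k x - H k y| < e / 2.
    apply: filter_forall => k; move/cvgrPdist_lt : (cH k x); apply.
    by rewrite divr_gt0.
  apply: filterS nH => y nH; apply: (@le_lt_trans _ _ (e / 2)); last lra.
  apply: dle => k; have [kN|Nk] := ltnP k N.
    rewrite /u ler_pdivrMr//; apply: (le_trans (ltW (nH (Ordinal kN)))).
    by rewrite ler_peMr ?ler1n// ltW// divr_gt0.
  apply: le_trans (u1 _ _ _) _; apply: ltW; apply: le_lt_trans Ne.
  by rewrite lef_pV2 ?posrE// ler_nat ltnS.
Qed.

End separation.

(** * Extension operators for compact subsets of a second countable subspace *)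

Section extension_operator.
Variables (R : realType) (X : topologicalType) (Y : set X) (d : X -> X -> R).
Hypotheses (pd : continuous_pseudometric d)
  (sepd : forall y y' : Y, d (set_val y) (set_val y') = 0 -> y = y')
  (scY : @second_countable Y).
Variables (K : set Y) (cK : compact K) (K0 : K !=set0).

Let d0 x : d x x = 0. Proof. by have [] := pd. Qed.
Let dC x y : d x y = d y x. Proof. by have [] := pd. Qed.
Let dD x y z : d x z <= d x y + d y z. Proof. by have [] := pd. Qed.
Let dnear x e : 0 < e -> \forall y \near x, d x y < e.
Proof. by have [_ _ _] := pd; exact. Qed.

Let d_ge0 x y : 0 <= d x y.
Proof. by have := dD x y x; rewrite d0 dC; lra. Qed.

Lemma lipschitz_cvg (f : X -> R) : (forall x y, f x <= d x y + f y) -> continuous f.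
Proof.
move=> fd x; apply/cvgrPdist_lt => e e0; apply: filterS (dnear x e0) => y dxy.
have := fd x y; have := fd y x; rewrite dC => h1 h2.
by apply: le_lt_trans dxy; rewrite ler_norml; lra.
Qed.

Lemma pseudometric_continuous x : continuous (d ^~ x).
Proof. by apply: lipschitz_cvg => y z; exact: dD. Qed.

Let cdK x : continuous (fun y : Y => d x (set_val y)).
Proof.
move=> y; rewrite (_ : (fun _ => _) = d ^~ x \o set_val); last first.
  by apply/funext => z; rewrite /= dC.
apply: continuous_comp; first exact: initial_continuous.
exact: pseudometric_continuous.
Qed.

Lemma exists_nearest : exists c : X -> Y,
  forall x, K (c x) /\ forall y, K y -> d x (set_val (c x)) <= d x (set_val y).
Proof.
suff /choice[c cP] : forall x, exists y, K y /\
    forall z, K z -> d x (set_val y) <= d x (set_val z) by exists c.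
move=> x; have [y yK yle] := compact_EVT_min K0 cK
  (continuous_subspaceT (@cdK x)).
exists y; split; first exact: set_mem.
by move=> z /mem_set; exact: yle.
Qed.

Lemma exists_dense_sequence : exists z : nat -> Y, (forall j, K (z j)) /\
  forall y e, K y -> 0 < e -> exists j, d (set_val y) (set_val (z j)) < e.
Proof.
have [e be] := second_countable_seq scY; have [y0 Ky0] := K0.
have : forall j, exists z, K z /\ ((K `&` e j) !=set0 -> e j z).
  move=> j; have [[z [Kz ejz]]|n] := pselect ((K `&` e j) !=set0).
    by exists z.
  by exists y0; split.
move=> /choice[z zP]; exists z; split=> [j|y r Ky r0]; first by have [] := zP j.
have [j [_ ejy ej]] : exists j, [/\ open (e j), e j y &
    e j `<=` [set y' | d (set_val y) (set_val y') < r]].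
  apply: be; move/cvgrPdist_lt : (@cdK (set_val y) y) => /(_ r r0).
  apply: filterS => y' /=.
  by rewrite d0 sub0r normrN => /(le_lt_trans (ler_norm _)).
exists j; apply: ej; have [_] := zP j; apply.
by exists y.
Qed.

Variables (c : X -> Y) (z : nat -> Y).
Hypothesis cP :
  forall x, K (c x) /\ forall y, K y -> d x (set_val (c x)) <= d x (set_val y).
Hypothesis zK : forall j, K (z j).
Hypothesis zdense :
  forall y e, K y -> 0 < e -> exists j, d (set_val y) (set_val (z j)) < e.

(** The distance from [x] to [K], attained at [c x]. *)
Definition gap x : R := d x (set_val (c x)).

(** Where [gap x] is positive, this is one when [z j] is within
    [3 / 2 * gap x] of [x], and zero beyond [2 * gap x]. *)
Definition tent x j : R := clamp (4 - 2 * (d x (set_val (z j)) / gap x)).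

Definition near_set x : set Y := [set y | K y /\ d x (set_val y) <= 2 * gap x].

(** On the zero set of [gap], which may be larger than [K], the point [c x] is
    the only point of [K] at distance zero from [x]. *)
Definition dugundji x (f : Y -> cplx R) : cplx R :=
  if gap x == 0 then f (c x)
  else \sum_(j \in [set: nat]) weight (peel (tent x) j) * f (z j).

Lemma gap_continuous : continuous gap.
Proof.
apply: lipschitz_cvg => x y; have [_ cx] := cP x; have [Kcy _] := cP y.
exact: le_trans (cx _ Kcy) (dD _ _ _).
Qed.

Let gap_ge0 x : 0 <= gap x. Proof. exact: d_ge0. Qed.

Let tent01 x j : 0 <= tent x j <= 1.
Proof. by rewrite clamp_ge0 clamp_le1. Qed.

Let tent1 x j : 0 < gap x -> d x (set_val (z j)) <= 3 / 2 * gap x -> tent x j = 1.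
Proof.
move=> dx le; apply: clamp1.
suff : d x (set_val (z j)) / gap x <= 3 / 2 by lra.
by rewrite ler_pdivrMr.
Qed.

Let tent_neq0 x j : 0 < gap x -> tent x j != 0 -> near_set x (z j).
Proof.
move=> dx tn; split=> //; rewrite leNgt; apply: contra tn => lt; apply/eqP.
apply: clamp0; suff : 2 <= d x (set_val (z j)) / gap x by lra.
by rewrite ler_pdivlMr// ltW.
Qed.

Let exists_near x : 0 < gap x -> exists j, d x (set_val (z j)) < 3 / 2 * gap x.
Proof.
move=> dx; have [Kcx _] := cP x.
have d40 : 0 < gap x / 4 by rewrite divr_gt0.
have [j zj] := zdense Kcx d40; exists j.
apply: le_lt_trans (dD x (set_val (c x)) _) _; rewrite -/(gap x); lra.
Qed.

Lemma dugundji_sum1 x : 0 < gap x -> \sum_(j \in [set: nat]) peel (tent x) j = 1.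
Proof.
move=> dx; have [m /ltW/(tent1 dx) tm] := exists_near dx.
rewrite (fsum_restrict (A := `I_m.+1)); last first.
  by move=> j /negP; rewrite -leqNgt => /(peel_eq0 tm).
by rewrite -fsbig_ord (peel_sum1 tm).
Qed.

Lemma peel_tent_finite x : 0 < gap x ->
  exists2 A, finite_set A & forall j, ~ A j -> peel (tent x) j = 0.
Proof.
move=> dx; have [m /ltW/(tent1 dx) tm] := exists_near dx.
exists `I_m.+1; first exact: finite_II.
by move=> j /negP; rewrite -leqNgt => /(peel_eq0 tm).
Qed.

(** Only points of [K] that are nearly closest to [x] contribute; this is what
    makes the extension continuous at the zero set of [gap]. *)
Lemma dugundji_submarkov x : submarkov (near_set x) (dugundji x).
Proof.
rewrite /dugundji; have [dx|dx] := eqVneq (gap x) 0.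
  apply: submarkov_eval; split; first by have [] := cP x.
  by rewrite dx mulr0 -/(gap x) dx.
have {}dx : 0 < gap x by rewrite lt_neqAle eq_sym dx gap_ge0.
have [A fA A0] := peel_tent_finite dx.
apply: (submarkov_fsum fA A0) => [j||j].
- exact: peel_ge0.
- by rewrite dugundji_sum1.
- rewrite /peel mulf_eq0 negb_or => /andP[tn _].
  exact/submarkov_eval/tent_neq0.
Qed.

Lemma dugundji_cst x (k : cplx R) : dugundji x (fun=> k) = k.
Proof.
rewrite /dugundji; have [//|dx] := eqVneq (gap x) 0.
have {}dx : 0 < gap x by rewrite lt_neqAle eq_sym dx gap_ge0.
have [A fA A0] := peel_tent_finite dx.
rewrite (fsum_seq fA) => [|j /A0->]; last by rewrite /weight mul0r.
rewrite -mulr_suml.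
rewrite (_ : \sum_(i <- _) _ = weight (\sum_(j <- finmap.enum_fset (fset_set A)) peel (tent x) j)).
  by rewrite -(fsum_seq fA A0) dugundji_sum1// /weight mul1r.
by rewrite /weight rmorph_sum.
Qed.

Lemma dugundji_val (y : Y) f : K y -> dugundji (set_val y) f = f y.
Proof.
move=> Ky; have [_ /(_ _ Ky)] := cP (set_val y); rewrite d0 => le.
have dy : gap (set_val y) = 0 by apply/eqP; rewrite eq_le le gap_ge0.
by rewrite /dugundji dy eqxx; congr f; apply/esym/sepd.
Qed.

(** At a point [x] with [gap x = 0], compactness of [K] turns closeness in the
    pseudometric [d] into closeness of the values of [f]; for [x'] near [x]
    all contributing points are within [3 * d x x'] of [x].  Where [gap] is
    positive the sum is locally finite with continuous terms. *)
Lemma dugundji_continuous f : continuous f -> continuous (dugundji ^~ f).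
Proof.
move=> cf x; have [dx|dx] := eqVneq (gap x) 0.
  have [Kcx _] := cP x; have fx : dugundji x f = f (c x) by rewrite /dugundji dx eqxx.
  rewrite /continuous_at fx; apply/cvgrPdist_lt => e e0; have e20 : 0 < e / 2 by rewrite divr_gt0.
  have [r r0 rP] : exists2 r, 0 < r & forall y, K y -> d x (set_val y) < r ->
      `|f (c x) - f y| < e / 2.
    pose A := K `&` [set y | e / 2 <= `|f (c x) - f y|].
    have cA : compact A.
      have cg : continuous (fun y => f (c x) - f y).
        move=> y; apply: (@cvgB _ _ _ (nbhs y) _ (fun=> f (c x)) f).
          exact: cvg_cst.
        exact: cf.
      exact: compact_closedI cK (closed_norm_ge e20 cg).
    have AP r : (forall y, A y -> r <= d x (set_val y)) -> forall y, K y ->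
        d x (set_val y) < r -> `|f (c x) - f y| < e / 2.
      move=> Ar y Ky lt; rewrite real_ltNge ?ger0_real ?(ltW e20)//.
      by apply/negP => ey; move: lt; rewrite ltNge Ar.
    have [A0|/set0P/negP/negPn/eqP A0] := pselect (A !=set0).
      have [y /set_mem[Ky ey] yle] := compact_EVT_min A0 cA
        (continuous_subspaceT (@cdK x)).
      exists (d x (set_val y)); last first.
        by apply: AP => y' /mem_set; exact: yle.
      rewrite lt_neqAle d_ge0 andbT; apply/eqP => dxy.
      have cy : c x = y.
        apply: sepd; apply/eqP; rewrite eq_le d_ge0 andbT.
        by apply: le_trans (dD _ x _) _; rewrite -dxy addr0 dC -/(gap x) dx.
      by move: ey; rewrite /= cy subrr normr0 (lt_geF e20).
    by exists 1 => //; apply: AP; rewrite A0.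
  (* A contributing [y] has [d x' y <= 2 * gap x' <= 2 * d x x']. *)
  have r30 : 0 < r / 3 by rewrite divr_gt0.
  apply: filterS (dnear x r30) => x' dxx'.
  have sm := dugundji_submarkov x'.
  have -> : f (c x) - dugundji x' f = dugundji x' (fun y => -1 * f y + f (c x)).
    by have [-> _ _] := sm; rewrite dugundji_cst mulN1r addrC.
  apply: (@le_lt_trans _ _ (e / 2)); last first.
    by rewrite ltr_pdivrMr// mulr_natr mulr2n ltrDl.
  have [_ _ bd] := sm; apply: bd; first exact: ltW.
  move=> y [Ky dy]; rewrite mulN1r addrC ltW// rP//.
  apply: le_lt_trans (dD x x' _) _.
  have : gap x' <= d x x'.
    have [_ /(_ _ Kcx)] := cP x'; rewrite -/(gap x') => /le_trans; apply.
    by apply: le_trans (dD _ x _) _; rewrite -/(gap x) dx addr0 dC.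
  lra.
have {}dx : 0 < gap x by rewrite lt_neqAle eq_sym dx gap_ge0.
have [m zm] := exists_near dx.
have nd : \forall x' \near x, 0 < gap x'.
  move/cvgrPdist_lt : (@gap_continuous x) => /(_ _ dx); apply: filterS => x'.
  by move=> /(le_lt_trans (ler_norm _)); lra.
have ct j : (fun x' => tent x' j) @ x --> tent x j.
  apply: cvg_clamp; apply: cvgB; first exact: cvg_cst.
  apply: cvgM; first exact: cvg_cst.
  apply: cvgM; first exact: pseudometric_continuous.
  by apply: cvgV; [rewrite gt_eqF|exact: gap_continuous].
have nm : \forall x' \near x, d x' (set_val (z m)) < 3 / 2 * gap x'.
  have ch : (fun x' => 3 / 2 * gap x' - d x' (set_val (z m))) @ x -->
      3 / 2 * gap x - d x (set_val (z m)).
    apply: cvgB; last exact: pseudometric_continuous.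
    by apply: cvgM; [exact: cvg_cst|exact: gap_continuous].
  move/cvgrPdist_lt : ch => /(_ (3 / 2 * gap x - d x (set_val (z m)))).
  rewrite subr_gt0 => /(_ zm); apply: filterS => x' /(le_lt_trans (ler_norm _)).
  lra.
have dE x' : 0 < gap x' -> dugundji x' f =
    \sum_(j \in [set: nat]) weight (peel (tent x') j) * f (z j).
  by move=> dx'; rewrite /dugundji gt_eqF.
rewrite /continuous_at dE//.
have : (fun x' => \sum_(j \in [set: nat]) weight (peel (tent x') j) * f (z j)) @ x
   --> \sum_(j \in [set: nat]) weight (peel (tent x) j) * f (z j).
  apply: (cvg_fsum (F := fun j x' => weight (peel (tent x') j) * f (z j))
    (finite_II m.+1)).
    near=> x' => j /negP; rewrite -leqNgt => mj.
    rewrite (@peel_eq0 _ (tent x') m)//; first by rewrite /weight mul0r.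
    by apply: tent1; [near: x'|apply: ltW; near: x'].
  move=> j; apply: cvgM; last exact: cvg_cst.
  apply: (@weight_cvg R _ (nbhs x) _ (fun x' => peel (tent x') j)).
  apply: cvgM => //; exact: (@cvg_prod_peel R X (nbhs x) _ (fun j x' => tent x' j)).
apply: cvg_trans; apply: near_eq_cvg.
by apply: filterS nd => x' /dE.
Unshelve. all: by end_near. Qed.

End extension_operator.

Lemma compact_extension_operator (R : realType) (X : topologicalType) (Y : set X)
    (K : set Y) : hausdorff_space X -> locally_compact [set: X] ->
  @second_countable Y -> compact K ->
  exists E : X -> (Y -> cplx R) -> cplx R,
    [/\ (forall x, submarkov K (E x)), (forall y f, K y -> E (set_val y) f = f y)
      & forall f, continuous f -> continuous (E ^~ f)].
Proof.
move=> hX lX scY cK.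
have [K0|/set0P/negP/negPn/eqP K0] := pselect (K !=set0); last first.
  exists (fun _ _ => 0); rewrite K0; split=> // [x|f _].
    exact: submarkov_cst0.
  exact: cst_continuous.
have [d [pd sepd]] := exists_pseudometric R hX lX scY.
have [c cP] := exists_nearest pd cK K0.
have [z [zK zdense]] := exists_dense_sequence pd scY K0.
exists (dugundji d c z); split.
- move=> x; apply: submarkov_sub (dugundji_submarkov pd cP zK zdense x).
  by move=> y [].
- by move=> y f Ky; exact: (dugundji_val pd sepd z cP).
- by move=> f cf; exact: (dugundji_continuous pd sepd cK cP zK zdense cf).
Qed.

(** * Proper actions: return times and bump functions covering [Y] *)

Lemma compact_set_val (X : topologicalType) (U K : set X) :
  K `<=` U -> compact K -> compact ((@set_val X U) @^-1` K).
Proof.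
move=> KU cK F FF FK.
have [p [Kp clp]] := cK (set_val @ F) (fmap_proper_filter _ FF) FK.
exists (exist _ p (mem_set (KU _ Kp))); split; first exact: Kp.
move=> A B FA [_ [[V oV <-] Vp] VB].
have FA' : (set_val @ F) (set_val @` A).
  by apply: (@filterS _ F _ A) FA => a Aa /=; exists a.
have [_ [[b Ab <-] Vb]] := clp _ _ FA' (open_nbhs_nbhs (conj oV Vp)).
by exists b; split => //; exact: VB.
Qed.

Lemma compact_discrete_finite (T : choiceType) (K : set (discrete_topology T)) :
  compact K -> finite_set K.
Proof.
move=> cK; apply: (compact_induction (P := @finite_set _) _ _ _ cK).
- exact: finite_set0.
- by move=> A B; exact: sub_finite_set.
- by move=> A B fA fB; rewrite finite_setU.
- by move=> x _; exists [set x]; [exact: discrete_set1|exact: finite_set1].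
Qed.

Section return_times.
Variables (G : groupType) (X : topologicalType) (a : homeo_action G X).

(** The only consequence of properness that the construction uses; it
    makes sense for arbitrary subsets and passes to smaller ones. *)
Definition finite_return (V : set X) : Prop := forall K, compact K -> K `<=` V ->
  finite_set [set g | exists2 x, K x & K (a g x)].

(** The return times of [K] are the first components of the preimage of
    [K `*` K], a compact subset of the discrete group. *)
Lemma proper_finite_return (U : set X) (iU : invariant_set a U) :
  proper_action (subaction iU) -> finite_return U.
Proof.
move=> [_ pr] K cK KU; have cK' := compact_set_val KU cK.
set K' := _ @^-1` K in cK'.
have cP := pr _ (compact_setX cK' cK').
set P := _ @^-1` _ in cP.
have cfst : compact ((fun p : discrete_topology G * U => p.1) @` P).
  apply: continuous_compact => //; apply: continuous_subspaceT => p.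
  exact: cvg_fst.
apply: sub_finite_set (compact_discrete_finite cfst).
move=> g [x Kx Kgx].
by exists (g, exist _ x (mem_set (KU _ Kx))).
Qed.

Lemma finite_returnS (V U : set X) : V `<=` U -> finite_return U -> finite_return V.
Proof. by move=> VU fU K cK KV; apply: fU => //; exact: subset_trans KV VU. Qed.

Lemma invariant_open_saturation (Y U : set X) : invariant_set a U -> invariant_set a Y ->
  set_nbhs Y U -> exists V, [/\ open V, invariant_set a V, Y `<=` V & V `<=` U].
Proof.
move=> iU iY /set_nbhsP[B [oB YB BU]].
exists (\bigcup_(g in [set: G]) (a g @^-1` B)); split.
- apply: bigcup_open => g _; apply: open_comp => // x _.
  exact: act_continuous.
- by move=> h x [g _ Bgx]; exists (g * h^-1)%g => //=; rewrite -actM -mulgA mulVg mulg1.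
- by move=> y Yy; exists 1%g => //=; rewrite act1; exact: YB.
- by move=> x [g _ /BU/(iU g^-1%g)]; rewrite -actM mulVg act1.
Qed.

End return_times.

Lemma compact_neighbourhood (R : realType) (X : topologicalType) (V : set X) x :
  hausdorff_space X -> locally_compact [set: X] -> open V -> V x ->
  exists Q, [/\ compact Q, Q `<=` V & nbhs x Q].
Proof.
move=> hX lX oV Vx.
have [A nA [h [S [[_ _ cS SV h0] h1]]]] := locally_bump R hX lX oV Vx.
exists S; split=> //; apply: filterS nA => y /h1 hy; apply: contrapT => /h0.
by rewrite hy => /eqP; rewrite oner_eq0.
Qed.

(** For each member of a countable base of [Y] choose a bump function equal to
    one near all of its points, if there is one. *)
Lemma countable_bump_cover (R : realType) (X : topologicalType) (V Y : set X) :
  hausdorff_space X -> locally_compact [set: X] -> open V -> Y `<=` V ->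
  @second_countable Y ->
  exists (h : nat -> X -> R) (S : nat -> set X),
    (forall n, bump V (S n) (h n)) /\
    forall y, Y y -> exists n, \forall x \near y, h n x = 1.
Proof.
move=> hX lX oV YV /second_countable_seq[e be].
pose one n (h : X -> R) := forall y : Y, e n y -> \forall x \near set_val y, h x = 1.
have /choice[p pP] : forall n, exists p : (X -> R) * set X, bump V p.2 p.1 /\
    ((exists q, bump V q.2 q.1 /\ one n q.1) -> one n p.1).
  move=> n; have [[q [bq oq]]|nq] :=
    pselect (exists q, bump V q.2 q.1 /\ one n q.1).
    by exists q.
  by exists (fun=> 0, set0); split=> //; exact: bump_cst0.
exists (fun n => (p n).1), (fun n => (p n).2); split.
  by move=> n; have [] := pP n.
move=> y Yy; have [A nA [h [S [bh h1]]]] := locally_bump R hX lX oV (YV _ Yy).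
pose y' : Y := exist _ y (mem_set Yy).
have [n [_ eny en]] : exists n, [/\ open (e n), e n y' &
    e n `<=` (set_val @^-1` A°)].
  by apply: be; apply: initial_continuous; exact: nbhs_interior nA.
exists n; have [_ /(_ _ y' eny)] := pP n; apply.
exists (h, S); split=> // z /en Az; rewrite /=.
by apply: filterS h1 _; exact: Az.
Qed.

Lemma submarkov_comp (C : numClosedFieldType) (Z Z' : Type) (K : set Z)
    (K' : set Z') (u : Z -> Z') (L : (Z -> C) -> C) :
  (forall z, K z -> K' (u z)) -> submarkov K L ->
  submarkov K' (fun f => L (fun z => f (u z))).
Proof.
move=> Ku [lL pL bL]; split=> [c f g|f f0|f M M0 fM].
- exact: lL.
- exact: pL.
- by apply: bL => // z /Ku; exact: fM.
Qed.

Lemma fsum_ge (R : numDomainType) (I : choiceType) (A : set I) (F : I -> R) i :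
  finite_set A -> (forall j, ~ A j -> F j = 0) -> (forall j, 0 <= F j) ->
  F i <= \sum_(j \in [set: I]) F j.
Proof.
move=> fA A0 F0; rewrite (fsum_seq fA A0).
have [Ai|/A0->] := pselect (A i); last by rewrite sumr_ge0.
rewrite (big_rem i)/=; last by rewrite in_fset_set// mem_set.
by rewrite lerDl sumr_ge0.
Qed.

(** * Gluing extension operators along a proper action *)

Section equivariant_extension.
Variables (R : realType) (G : groupType) (X : topologicalType)
  (a : homeo_action G X) (Y : set X) (cY : closed Y) (iY : invariant_set a Y).
Hypotheses (hX : hausdorff_space X) (lX : locally_compact [set: X]).
Variable V : set X.
Hypotheses (oV : open V) (iV : invariant_set a V) (YV : Y `<=` V)
  (finV : finite_return a V).
Variables (eta : nat -> X -> R) (S : nat -> set X).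
Hypothesis etaP : forall n, bump V (S n) (eta n).
Hypothesis eta1 : forall y, Y y -> exists n, \forall x \near y, eta n x = 1.

Let eta_ge0 n x : 0 <= eta n x.
Proof. by have [_ /(_ x)/andP[] ] := etaP n. Qed.

Let etaS n x : ~ S n x -> eta n x = 0.
Proof. by have [_ _ _ _] := etaP n; exact. Qed.

Let actVK g x : a g (a g^-1%g x) = x.
Proof. by rewrite -actM mulgV act1. Qed.

Let actKV g x : a g^-1%g (a g x) = x.
Proof. by rewrite -actM mulVg act1. Qed.

Lemma finite_hit Q n : compact Q -> Q `<=` V ->
  finite_set [set g | exists2 x, Q x & S n (a g^-1%g x)].
Proof.
move=> cQ QV; have [_ _ cS SV _] := etaP n.
have QSV : Q `|` S n `<=` V by move=> x [/QV|/SV].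
apply: sub_finite_set (finV (compactU cQ cS) QSV) => g [x Qx Sx]; exists (a g^-1%g x); first by right.
by rewrite actVK; left.
Qed.

(** The orbit sum of [eta n]; by [finite_hit] it is locally finite on [V]. *)
Definition sigma n x : R := \sum_(g \in [set: G]) eta n (a g^-1%g x).

Definition theta n x : R := Num.min 1 (sigma n x).

Lemma sigma_invariant n h x : sigma n (a h x) = sigma n x.
Proof.
rewrite /sigma (reindex_fsbigT (fun k => h * k)%g); last first.
  by exists (fun k => h^-1 * k)%g => k; rewrite mulgA ?mulVg ?mulgV mul1g.
by apply: eq_fsbigr => g _; rewrite invgM -actM -mulgA mulVg mulg1.
Qed.

Lemma theta_invariant n h x : theta n (a h x) = theta n x.
Proof. by rewrite /theta sigma_invariant. Qed.

Let V_near x : V x -> exists Q, [/\ compact Q, Q `<=` V & nbhs x Q].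
Proof. exact: compact_neighbourhood. Qed.

Let act_cvg g x : a g @ x --> a g x. Proof. exact: act_continuous. Qed.

Lemma sigma_cvg n x : V x -> sigma n @ x --> sigma n x.
Proof.
move=> /V_near[Q [cQ QV nQ]].
apply: (cvg_fsum (F := fun g x => eta n (a g^-1%g x)) (finite_hit n cQ QV)).
  by apply: filterS nQ => y Qy g ng; apply: etaS => Sy; apply: ng; exists y.
move=> g; apply: continuous_comp; first exact: act_cvg.
by have [+ _ _ _ _] := etaP n; exact.
Qed.

Lemma theta_cvg n x : V x -> theta n @ x --> theta n x.
Proof.
by move=> Vx; apply: cvg_minr; [exact: cvg_cst|exact: sigma_cvg].
Qed.

Lemma sigma_ge n x : V x -> eta n x <= sigma n x.
Proof.
move=> Vx; have xV : [set x] `<=` V by move=> _ ->.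
have -> : eta n x = eta n (a 1^-1%g x) by rewrite invg1 act1.
apply: (fsum_ge (F := fun g => eta n (a g^-1%g x)) 1%g
  (finite_hit n (@compact_set1 _ x) xV)) => //.
by move=> g ng; apply: etaS => Sg; apply: ng; exists x.
Qed.

Lemma sigma_ge0 n x : 0 <= sigma n x.
Proof. exact: fsumr_ge0. Qed.

Lemma theta01 x n : 0 <= theta n x <= 1.
Proof. by rewrite /theta le_min ler01 sigma_ge0 ge_min lexx. Qed.

(** The invariant open set on which the translates of all the [psi n]
    form a locally finite family. *)
Definition core : set X :=
  [set x | V x /\ exists n, \forall x' \near x, theta n x' = 1].

Lemma core_open : open core.
Proof.
rewrite openE => x [Vx [n nx]]; rewrite /interior.
have nV : nbhs x V by exact: open_nbhs_nbhs.
near=> y; split; first by near: y.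
by exists n; near: y; apply: (nbhs_interior nx).
Unshelve. all: by end_near. Qed.

Lemma core_invariant : invariant_set a core.
Proof.
move=> g x [Vx [n nx]]; split; first exact: iV.
exists n; have : \forall y \near a g x, theta n (a g^-1%g y) = 1.
  by apply: (@act_cvg _ _ [set y | theta n y = 1]); rewrite actKV.
by apply: filterS => y; rewrite theta_invariant.
Qed.

Lemma sub_core : Y `<=` core.
Proof.
move=> y Yy; split; first exact: YV.
have [n ny] := eta1 Yy; exists n.
have nV : nbhs y V by apply: open_nbhs_nbhs; split=> //; exact: YV.
apply: filterS2 ny nV => x e1 Vx; rewrite /theta min_l// -e1.
exact: sigma_ge.
Qed.

Variables (cut : nat -> X -> R) (T : nat -> set X).
Hypothesis cutP : forall n, bump core (T n) (cut n).
Hypothesis cut1 : forall n x, (Y `&` S n) x -> cut n x = 1.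

(** Up to the factor [cut n], on [V] the translates of [psi n] by [G] sum to
    [peel (theta ^~ x) n]: dividing by [max 1 (sigma n x)] turns the orbit sum
    [sigma n] into its truncation [theta n].  The factor [cut n] is one at the
    points of [Y] that matter, and keeps the support of [psi n] inside [core]. *)
Definition psi n x : R := \prod_(i < n) (1 - theta i x) *
  (eta n x * cut n x / Num.max 1 (sigma n x)).

Definition supp n : set X := closure [set x | psi n x != 0].

Let max_gt0 n x : 0 < Num.max 1 (sigma n x).
Proof. by rewrite lt_max ltr01. Qed.

Lemma psi_ge0 n x : 0 <= psi n x.
Proof.
apply: mulr_ge0.
  by apply: prodr_ge0 => i _; rewrite subr_ge0; have /andP[] := theta01 x i.
apply: mulr_ge0; last by rewrite invr_ge0 ltW.
by apply: mulr_ge0 => //; have [_ /(_ x)/andP[]] := cutP n.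
Qed.

Lemma psi_cvg n x : V x -> psi n @ x --> psi n x.
Proof.
move=> Vx; apply: cvgM.
  by apply: (@cvg_prod_peel R X (nbhs x) _ theta (theta ^~ x)) => i; exact: theta_cvg.
apply: cvgM.
  apply: cvgM; first by have [+ _ _ _ _] := etaP n; exact.
  by have [+ _ _ _ _] := cutP n; exact.
apply: cvgV; first by rewrite gt_eqF.
by apply: cvg_maxr; [exact: cvg_cst|exact: sigma_cvg].
Qed.

Lemma supp_sub n : supp n `<=` S n `&` T n.
Proof.
have [_ _ cS _ _] := etaP n; have [_ _ cT _ T0] := cutP n.
have /closure_id -> : closed (S n `&` T n) by apply: closedI; exact: compact_closed.
apply: closureS => x /= px; split.
  apply: contrapT => /etaS e0; move: px; rewrite /psi e0 !mul0r mulr0 eqxx//.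
apply: contrapT => /T0 e0; move: px; rewrite /psi e0 mulr0 mul0r mulr0 eqxx//.
Qed.

Lemma supp_compact n : compact (supp n).
Proof.
have [_ _ cS _ _] := etaP n.
apply: (subclosed_compact _ cS); first exact: closed_closure.
by move=> x /supp_sub[].
Qed.

Lemma supp_core n : supp n `<=` core.
Proof. by have [_ _ _ TW _] := cutP n; move=> x /supp_sub[_ /TW]. Qed.

Lemma psi_supp n x : psi n x != 0 -> supp n x.
Proof. by move=> px; apply: (@subset_closure _ [set y | psi n y != 0]). Qed.

(** Local finiteness on [core] of the family of all translates of all the
    supports.  Near a point where [theta m] is one, [psi n] and its translates
    vanish for [n] larger than [m], and for each of the remaining [n] only
    finitely many translates come near. *)
Lemma finite_supp_hit Q : compact Q -> Q `<=` core ->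
  finite_set [set p : nat * G | exists2 x, Q x & supp p.1 (a p.2^-1%g x)].
Proof.
move=> cQ QW; apply: (compact_induction
  (P := fun A => finite_set [set p : nat * G | exists2 x, A x & supp p.1 (a p.2^-1%g x)])
  _ _ _ cQ).
- by rewrite (_ : mkset _ = set0)//; apply/seteqP; split=> // p [].
- move=> A B AB; apply: sub_finite_set => p [x Ax Dx]; exists x => //.
  exact: AB.
- move=> A B fA fB.
  apply: (@sub_finite_set _ _ ([set p | exists2 x, A x & supp p.1 (a p.2^-1%g x)]
      `|` [set p | exists2 x, B x & supp p.1 (a p.2^-1%g x)])).
    by move=> p [x [Ax|Bx] Dx]; [left|right]; exists x.
  by rewrite finite_setU.
move=> x /QW[Vx [m nx]]; have [N [cN NV nN]] := V_near Vx.
exists (N `&` [set y | \forall z \near y, theta m z = 1]).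
  by apply: filterI => //; exact: nbhs_interior nx.
apply: (@sub_finite_set _ _ (`I_m.+1 `*`
    \bigcup_(n in `I_m.+1) [set g | exists2 x, N x & S n (a g^-1%g x)])).
  move=> [n g] [y [Ny ny] /= Dy].
  have nm : (n < m.+1)%N.
    rewrite ltnS leqNgt; apply/negP => mn.
    have nz : nbhs (a g^-1%g y) [set z | theta m (a g z) = 1].
      by have := @act_cvg g (a g^-1%g y); rewrite actVK => /(_ _ ny).
    have [z [/= + tz]] := Dy _ nz; rewrite theta_invariant in tz.
    rewrite /psi (@prod_peel0 R (theta ^~ z) m n)// mul0r eqxx//.
  split=> //=; exists n => //; exists y => //.
  by have [] := supp_sub Dy.
apply: finite_setX; first exact: finite_II.
by apply: bigcup_finite => [|n _]; [exact: finite_II|exact: finite_hit].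
Qed.

Definition kernel_weight x (p : nat * G) : R := psi p.1 (a p.2^-1%g x).

Lemma kernel_weight_ge0 x p : 0 <= kernel_weight x p. Proof. exact: psi_ge0. Qed.

Lemma psi_out n g x : ~ core x -> psi n (a g^-1%g x) = 0.
Proof.
move=> nW; apply/eqP; apply: contra_notT nW => /psi_supp/supp_core.
by move=> /(core_invariant g); rewrite actVK.
Qed.

Lemma finite_weights x : exists2 A, finite_set A & forall p, ~ A p -> kernel_weight x p = 0.
Proof.
have [Wx|nWx] := pselect (core x); last first.
  by exists set0 => [|p _]; [exact: finite_set0|exact: psi_out].
exists [set p | exists2 y, [set x] y & supp p.1 (a p.2^-1%g y)].
  by apply: finite_supp_hit; [exact: compact_set1|move=> _ ->].
move=> p np; apply/eqP; apply: contra_notT np => /psi_supp Dx.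
by exists x.
Qed.

Lemma psiE n g x : psi n (a g^-1%g x) = \prod_(i < n) (1 - theta i x) *
  (eta n (a g^-1%g x) * cut n (a g^-1%g x)) / Num.max 1 (sigma n x).
Proof.
rewrite /psi sigma_invariant mulrA; congr (_ * _ / _).
by apply: eq_bigr => i _; rewrite theta_invariant.
Qed.

Lemma theta_div n x : sigma n x / Num.max 1 (sigma n x) = theta n x.
Proof.
rewrite /theta; have [s1|s1] := leP (sigma n x) 1.
  by rewrite invr1 mulr1.
by rewrite divff// gt_eqF// (lt_trans ltr01).
Qed.

(** At a given point of [core] everything happens in a finite rectangle of
    indices, where double sums can be rearranged. *)
Lemma sum_weights x : core x ->
  exists m (F : set G), [/\ finite_set F, theta m x = 1,
    forall n, (n < m.+1)%N -> \sum_(g \in F) eta n (a g^-1%g x) = sigma n x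
    & \sum_(p \in [set: nat * G]) kernel_weight x p =
      \sum_(n < m.+1) \sum_(g \in F) kernel_weight x (val n, g)].
Proof.
move=> [Vx [m nx]]; have tx := nbhs_singleton nx.
pose F := \bigcup_(n in `I_m.+1)
  [set g | exists2 y, [set x] y & S n (a g^-1%g y)].
have fF : finite_set F.
  apply: bigcup_finite => [|n _]; first exact: finite_II.
  by apply: finite_hit; [exact: compact_set1|move=> _ ->].
have eta0 n g : (n < m.+1)%N -> ~ F g -> eta n (a g^-1%g x) = 0.
  by move=> nm nF; apply: etaS => Sx; apply: nF; exists n => //; exists x.
exists m, F; split=> //.
  by move=> n nm; rewrite /sigma (fsum_restrict (A := F))// => g; exact: eta0.
rewrite (fsum_restrict (A := `I_m.+1 `*` F)); last first.
  move=> [n g] np; rewrite /kernel_weight psiE/=; have [nm|mn] := ltnP n m.+1.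
    by rewrite eta0 ?mul0r ?mulr0 ?mul0r// => Fg; apply: np.
  by rewrite (@prod_peel0 R (theta ^~ x) m n)// !mul0r.
rewrite -(@pair_fsbig _ _ _ _ _ _ _ (fun n g => kernel_weight x (n, g)))//.
by rewrite -fsbig_ord.
Qed.

Lemma sum_weights_le1 x : \sum_(p \in [set: nat * G]) kernel_weight x p <= 1.
Proof.
have [/sum_weights[m [F [fF _ sF ->]]]|nWx] := pselect (core x); last first.
  by rewrite fsbig1// => p _; exact: psi_out.
apply: le_trans (peel_sum_le1 m.+1 (theta01 x)).
apply: ler_sum => n _; rewrite /peel -theta_div -{1}sF//.
rewrite mulrC mulrA [in leRHS]fsbig_finite// [in leLHS]fsbig_finite//=.
rewrite mulr_sumr mulr_suml; apply: ler_sum => g _; rewrite /kernel_weight psiE/=.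
apply: ler_wpM2r; first by rewrite invr_ge0 ltW.
apply: ler_wpM2l.
  by apply: prodr_ge0 => i _; rewrite subr_ge0; have /andP[] := theta01 x i.
have [_ /(_ (a g^-1%g x))/andP[c0 c1] _ _ _] := cutP n.
by rewrite ler_piMr.
Qed.

Lemma sum_weights1 y : Y y -> \sum_(p \in [set: nat * G]) kernel_weight y p = 1.
Proof.
move=> Yy; have [m [F [fF tm sF ->]]] := sum_weights (sub_core Yy).
rewrite -(@peel_sum1 R (theta ^~ y) m m.+1)//.
apply: eq_bigr => n _; rewrite /peel -theta_div -{1}sF//.
rewrite mulrC mulrA [in RHS]fsbig_finite// [in LHS]fsbig_finite//=.
rewrite mulr_sumr mulr_suml; apply: eq_bigr => g _; rewrite /kernel_weight psiE/=.
congr (_ * _ / _).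
have [Sy|/etaS->] := pselect (S n (a g^-1%g y)); last by rewrite mul0r.
rewrite cut1 ?mulr1//; split=> //; exact: iY.
Qed.

Definition trace n : set Y := set_val @^-1` supp n.

Variable E : nat -> X -> (Y -> cplx R) -> cplx R.
Hypothesis EP : forall n,
  [/\ (forall x, submarkov (trace n) (E n x)),
      (forall y f, trace n y -> E n (set_val y) f = f y)
    & forall f, continuous f -> continuous (E n ^~ f)].

(** Averaging over the group makes the operators [E n] equivariant: the
    substitution of [h * g] for [g] moves [h] from the point to the
    function. *)
Definition equivariant_kernel x (f : Y -> cplx R) : cplx R :=
  \sum_(p \in [set: nat * G])
    weight (kernel_weight x p) * E p.1 (a p.2^-1%g x) (fun y => f (subact iY p.2 y)).

Lemma kernel_submarkov K' x :
  (forall p y, kernel_weight x p != 0 -> trace p.1 y -> K' (subact iY p.2 y)) ->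
  submarkov K' (equivariant_kernel x).
Proof.
move=> KK'; have [A fA A0] := finite_weights x.
apply: (submarkov_fsum (L := fun p f => E p.1 (a p.2^-1%g x)
  (fun y => f (subact iY p.2 y))) fA A0).
- by move=> p; exact: kernel_weight_ge0.
- exact: sum_weights_le1.
move=> p wp; apply: (submarkov_comp (K := trace p.1)).
  by move=> y; exact: KK'.
by have [+ _ _] := EP p.1; exact.
Qed.

Lemma kernel_restrict (y : Y) f : equivariant_kernel (set_val y) f = f y.
Proof.
rewrite /equivariant_kernel.
have [A fA A0] := finite_weights (set_val y).
transitivity (\sum_(p \in [set: nat * G]) weight (kernel_weight (set_val y) p) * f y).
  apply: eq_fsbigr => p _; have [->|wp] := eqVneq (kernel_weight (set_val y) p) 0.
    by rewrite /weight !mul0r.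
  congr (_ * _); rewrite -[a _ _]/(set_val (subact iY p.2^-1%g y)).
  have [_ Ey _] := EP p.1; rewrite Ey; last exact: psi_supp.
  by congr f; apply: val_inj; rewrite /= actVK.
rewrite (fsum_seq fA) => [|p /A0->]; last by rewrite /weight mul0r.
rewrite -mulr_suml (_ : \sum_(i <- _) _ =
    weight (\sum_(p <- finmap.enum_fset (fset_set A)) kernel_weight (set_val y) p)).
  by rewrite -(fsum_seq fA A0) sum_weights1 ?/weight ?mul1r//; exact: set_valP.
by rewrite /weight rmorph_sum.
Qed.

Lemma kernel_equivariant h x f :
  equivariant_kernel (a h x) f = equivariant_kernel x (fun y => f (subact iY h y)).
Proof.
rewrite /equivariant_kernel (reindex_fsbigT (fun p : nat * G => (p.1, h * p.2)%g)).
  apply: eq_fsbigr => -[n g] _ /=; rewrite /kernel_weight/=.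
  have -> : a (h * g)^-1%g (a h x) = a g^-1%g x.
    by rewrite invgM -actM -mulgA mulVg mulg1.
  congr (_ * E _ _ _); apply/funext => y; congr f.
  by apply: val_inj; rewrite /= actM.
by exists (fun p => (p.1, h^-1 * p.2)%g) => -[n g] /=;
  rewrite mulgA ?mulVg ?mulgV mul1g.
Qed.

Lemma kernel_cvg f x : continuous f -> core x ->
  equivariant_kernel ^~ f @ x --> equivariant_kernel x f.
Proof.
move=> cf Wx.
have [Q [cQ QW nQ]] := compact_neighbourhood R hX lX core_open Wx.
apply: (cvg_fsum (F := fun p x => weight (kernel_weight x p) *
   E p.1 (a p.2^-1%g x) (fun y => f (subact iY p.2 y))) (finite_supp_hit cQ QW)).
  apply: filterS nQ => y Qy p np; suff -> : kernel_weight y p = 0 by rewrite /weight mul0r.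
  by apply/eqP; apply: contra_notT np => /psi_supp Dy; exists y.
move=> p; apply: cvgM.
  apply: (@weight_cvg R _ (nbhs x) _ (fun x => kernel_weight x p)).
  apply: (@cvg_comp _ _ _ _ (psi p.1)); first exact: act_cvg.
  by apply: psi_cvg; apply: iV; have [] := Wx.
apply: (@cvg_comp _ _ _ _ (E p.1 ^~ (fun y => f (subact iY p.2 y)))).
  exact: act_cvg.
have [_ _ cE] := EP p.1; apply: cE => y.
by apply: continuous_comp; [exact: subact_continuous|exact: cf].
Qed.

(** If [x] lies outside the finitely many translated supports that meet the set
    where [`|f|] is at least [e / 2], then only values of [f] smaller than
    [e / 2] contribute to the kernel at [x]. *)
Lemma kernel_C0 (f : C0 (cplx R) Y) :
  equivariant_kernel ^~ f \in @C0_pred (cplx R) X.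
Proof.
have [cf vf] := C0P f.
apply: (C0_zero_extension (W := core)) => // [x nWx|x Wx|e e0].
- by rewrite /equivariant_kernel fsbig1// => p _; rewrite /kernel_weight psi_out// /weight mul0r.
- exact: kernel_cvg.
have e20 : 0 < e / 2 by rewrite divr_gt0.
pose Q0 := set_val @` [set y | e / 2 <= `|f y|].
have cQ0 : compact Q0.
  apply: continuous_compact; last exact: vf.
  by apply: continuous_subspaceT; exact: initial_continuous.
have Q0W : Q0 `<=` core by move=> _ [y _ <-]; apply: sub_core; exact: set_valP.
have fA := finite_supp_hit cQ0 Q0W; set A := mkset _ in fA.
exists (\bigcup_(p in A) (a p.2 @` supp p.1)); split.
- rewrite -(bigsetU_fset_set (fun p => a p.2 @` supp p.1) fA).
  apply: bigsetU_compact => p _.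
  apply: continuous_compact; last exact: supp_compact.
  by apply: continuous_subspaceT => x; exact: act_continuous.
- by move=> _ [p _ [x /supp_core Wx <-]]; exact: core_invariant.
move=> x nQ; apply: (@le_lt_trans _ _ (e / 2)); last first.
  by rewrite ltr_pdivrMr// mulr_natr mulr2n ltrDl.
have [_ _] : submarkov [set y | `|f y| <= e / 2] (equivariant_kernel x).
  apply: kernel_submarkov => p y wp Ky; apply: contrapT => fy.
  apply: nQ; exists p; last first.
    by exists (a p.2^-1%g x); [exact: psi_supp|rewrite actVK].
  exists (set_val (subact iY p.2 y)); last by rewrite /= actKV.
  exists (subact iY p.2 y) => //=; move: fy => /negP.
  by rewrite -real_ltNge ?ger0_real ?(ltW e20)// => /ltW.
by apply=> //; exact: ltW.
Qed.

Lemma equivariant_split_closed : split_closed R cY iY.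
Proof.
apply: (@split_closed_of_kernel R G X a Y cY iY equivariant_kernel).
- by move=> x; exact: kernel_submarkov.
- exact: kernel_C0.
- by move=> y f; exact: kernel_restrict.
- exact: kernel_equivariant.
Qed.

End equivariant_extension.

Lemma proper_split_closed (R : realType) (G : groupType) (X : topologicalType)
    (a : homeo_action G X) (Y : set X) (cY : closed Y) (iY : invariant_set a Y)
    (U : set X) (iU : invariant_set a U) :
  hausdorff_space X -> locally_compact [set: X] -> set_nbhs Y U ->
  proper_action (subaction iU) -> @second_countable Y -> split_closed R cY iY.
Proof.
move=> hX lX YU pU scY.
have [V [oV iV YV VU]] := invariant_open_saturation iU iY YU.
have finV := finite_returnS VU (proper_finite_return pU).
have [eta [S [etaP eta1]]] := countable_bump_cover R hX lX oV YV scY.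
pose W := core a V eta.
have oW : open W := core_open a oV eta.
have YW : Y `<=` W := sub_core oV YV finV etaP eta1.
have /choice[q qP] : forall n, exists p : (X -> R) * set X,
    bump W p.2 p.1 /\ forall x, (Y `&` S n) x -> p.1 x = 1.
  move=> n; have cYS : compact (Y `&` S n).
    by rewrite setIC; apply: compact_closedI => //; have [] := etaP n.
  have [|h [T hT]] := compact_bump R hX lX oW cYS.
    by move=> x [/YW].
  by exists (h, T).
pose cut n := (q n).1; pose T n := (q n).2.
have cutP n : bump W (T n) (cut n) by have [] := qP n.
have cut1 n x : (Y `&` S n) x -> cut n x = 1 by have [_ + ] := qP n; exact.
have cK n : compact ((@set_val X Y) @^-1` supp a eta cut n).
  apply: compact_set_val_preimage => //.
  exact: (supp_compact hX etaP cutP).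
have /choice[E EP] := fun n => @compact_extension_operator R _ _ _ hX lX scY (cK n).
exact: (@equivariant_split_closed R G X a Y cY iY hX lX V oV iV YV finV eta S
  etaP eta1 cut T cutP cut1 E EP).
Qed.

(** * The theorem *)

Theorem proposition1p12 (R : realType) (G : groupType) (X : topologicalType)
    (a : homeo_action G X) (Y : set X)
    (cY : closed Y) (iY : invariant_set a Y) :
  countable [set: G] -> hausdorff_space X -> locally_compact [set: X] ->
  ((exists (U : set X) (iU : invariant_set a U),
      set_nbhs Y U /\ proper_action (subaction iU)) ->
    @second_countable Y -> split_closed R cY iY)
  /\ (invariant_tube R iY -> split_closed R cY iY).
Proof.
move=> _ hX lX; split=> [[U [iU [YU pU]]] scY|tube].
  exact: (@proper_split_closed R G X a Y cY iY U iU hX lX YU pU scY).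
exact: tube_split_closed.
Qed.
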